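(* There exist positive constants $c_1$ and $c_2$ depending only on $\alpha$, $M$ and $q$ such that $$\inf_{w_\tau\in\mathcal{S}_\tau}\sup_{v_\tau\in\mathcal{S}_\tau}\frac{B_\tau(w_\tau,v_\tau)}{\|w_\tau\|_{\mathcal{X},\tau}\,\|v_\tau\|_{\mathcal{Y},\tau,\#}}= c_1,$$ $$\inf_{w_\tau\in\mathcal{S}_\tau}\sup_{v_\tau\in\mathcal{S}_\tau}\frac{B_\tau(w_\tau,v_\tau)}{|\!|\!|w_\tau|\!|\!|_{\mathcal{Y},\tau,\#}\,|\!|\!|v_\tau|\!|\!|_{\mathcal{X},\tau}}= c_2.$$
   Context: Let $H$ and $V$ be real Hilbert spaces with $V\subset H$ dense and the injection continuous. Norms are $\|\cdot\|_V$ and $\|\cdot\|=\|\cdot\|_H$; $(\cdot,\cdot)$ is the inner product of $H$. Identify $H$ with its dual $H'$, so that $V\subset H\subset V'$, and let $\langle\cdot,\cdot\rangle$ be the duality pairing between $V'$ and $V$. Let $T>0$, $J=(0,T)$. For a.e. $t\in J$ a linear operator $A(t):V\to V'$ is given, and there are positive constants $M,\alpha$ independent of $t$ such that for a.e. $t\in J$: $|\langle A(t)w,v\rangle|\le M\|w\|_V\|v\|_V$ for all $w,v\in V$, and $\langle A(t)v,v\rangle\ge\alpha\|v\|_V^2$ for all $v\in V$. Partition: $0=t_0<t_1<\cdots<t_N=T$, $J_n=(t_n,t_{n+1}]$, $\tau_n=t_{n+1}-t_n$ ($0\le n\le N-1$), $\tau=\max_n\tau_n$, and it is assumed that $\tau\le1$.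 For an integer $q\ge0$, $\mathcal{S}_\tau$ is the set of functions $v$ on $(0,T]$ such that for each $n$ the restriction $v|_{J_n}$ is a $V$-valued polynomial in $t$ of degree $\le q$. Write $v^{n,+}=\lim_{t\downarrow t_n}v(t)$ and $v^{n+1}=v(t_{n+1})$ for $n=0,\dots,N-1$. Derivatives $v'$ are taken on each $J_n$. Set $$B_\tau(w,v)=\sum_{n=0}^{N-1}\int_{J_n}\left[(w',v)+\langle A(t)w,v\rangle\right]dt+(w^{0,+},v^{0,+})+\sum_{n=1}^{N-1}(w^{n,+}-w^n,v^{n,+}).$$ Norms on $\mathcal{S}_\tau$: $\|v\|_{\mathcal{X},\tau}^2=\sum_{n=0}^{N-1}\int_{J_n}[\|v'\|_{V'}^2+\|v\|_V^2]dt+\|v^{0,+}\|^2+\sum_{n=1}^{N-1}\|v^{n,+}-v^n\|^2$; $\|v\|_{\mathcal{Y},\tau,\#}^2=\sum_{n=0}^{N-1}\int_{J_n}\|v\|_V^2dt+\|v^{0,+}\|^2+\sum_{n=1}^{N-1}\tau_n\|v^{n,+}\|^2$; $|\!|\!|v|\!|\!|_{\mathcal{X},\tau}^2=\sum_{n=0}^{N-1}\int_{J_n}[\|v'\|_{V'}^2+\|v\|_V^2]dt+\|v^N\|^2+\sum_{n=1}^{N-1}\|v^{n,+}-v^n\|^2$; $|\!|\!|v|\!|\!|_{\mathcal{Y},\tau,\#}^2=\sum_{n=0}^{N-1}\int_{J_n}\|v\|_V^2dt+\|v^N\|^2+\sum_{n=1}^{N-1}\tau_n\|v^{n,+}\|^2$.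 Infima and suprema of the quotients are over nonzero elements.
   Formalization: Literal equality with constants depending only on α, M, q is false; proved instead: each inf-sup is ≥ c_i > 0 (and finite if V ≠ {0}), where c_i may also depend on a bound K of the injection V→H (‖v‖ ≤ K‖v‖_V); weak measurability of A(t) is assumed. *)

(* Defs.v *)
From HB Require Import structures.
From mathcomp Require Import all_boot all_order all_algebra.
From mathcomp Require Import sesquilinear.
From mathcomp Require Import all_classical all_reals all_analysis.

Set Implicit Arguments.
Unset Strict Implicit.
Unset Printing Implicit Defensive.

Import Order.TTheory GRing.Theory Num.Theory.
Import numFieldNormedType.Exports.

Local Open Scope classical_set_scope.
Local Open Scope ring_scope.

(* A real Hilbert space is a complete normed module with a positive definite
   symmetric bilinear form inducing its norm. *)
Definition induces_norm (R : realType) (H : completeNormedModType R)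
    (ip : {dot H for idfun}) : Prop :=
  forall x : H, ip x x = `|x| ^+ 2.

(* Elements of V' are represented by the functions V -> R satisfying this
   predicate. *)
Definition in_dual (R : realType) (V : completeNormedModType R)
    (f : V -> R) : Prop :=
  scalar f /\ continuous (f : V -> R^o).

Definition dual_norm (R : realType) (V : completeNormedModType R)
    (f : V -> R) : R :=
  sup [set `|f v| / `|v| | v in [set v : V | v != 0]].

(* The inclusions V `<=` H `<=` V' are the map iota : V -> H and the map
   sending h : H to the functional v |-> (h, iota v). *)
Definition to_dual (R : realType) (H V : completeNormedModType R)
    (ipH : {dot H for idfun}) (iota : V -> H) (h : H) : V -> R :=
  fun v => ipH h (iota v).

(* An operator A(t) : V -> V' is given as the function A t, with
   A t w v = <A(t) w, v>. *)
Definition linear_to_dual (R : realType) (V : completeNormedModType R)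
    (a : V -> V -> R) : Prop :=
  (forall w, in_dual (a w)) /\
  (forall (k : R) w1 w2 v, a (k *: w1 + w2) v = k * a w1 v + a w2 v).

(* Lebesgue measurability on D: the library's sigma-algebra on R is the Borel
   one, hence the passage to an almost everywhere equal Borel function. *)
Definition Lmeasurable_fun (R : realType) (D : set R) (f : R -> R) : Prop :=
  exists2 g : R -> R, measurable_fun D g &
    {ae (@lebesgue_measure R), forall s : R, D s -> f s = g s}.

Section DG.
Context {R : realType} {H V : completeNormedModType R}.
Implicit Types (ipH : {dot H for idfun}) (iota : V -> H) (A : R -> V -> V -> R).
Implicit Types (N q : nat) (t : nat -> R) (v w : R -> V).

(* Only t 0, ..., t N are relevant. *)
Definition is_partition (T : R) N t : Prop :=
  [/\ t 0%N = 0, t N = T & forall n, (n < N)%N -> t n < t n.+1].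

Definition step t (n : nat) : R := t n.+1 - t n.

Definition mesh N t : R := \big[Num.max/0]_(n < N) step t n.

Definition J t (n : nat) : set R := `]t n, t n.+1].

(* Functions are total on R; only their values on ]0, T] are relevant. *)
Definition Stau q N t : set (R -> V) :=
  [set v | forall n, (n < N)%N -> exists c : 'I_q.+1 -> V,
     forall s, J t n s -> v s = \sum_(i < q.+1) s ^+ i *: c i].

Definition nonzero_on (T : R) : set (R -> V) :=
  [set v | exists2 s, `]0, T]%classic s & v s != 0].

Definition vplus t v (n : nat) : V := lim (v s @[s --> (t n)^'+]).

Definition jump t v (n : nat) : V := vplus t v n - v (t n).

(* derive1 v is two-sided, so it may fail to be v' at the right end
   of J t n; this single point does not contribute to the integrals. *)
Definition Btau ipH iota A N t w v : R :=
  \sum_(0 <= n < N) \int[lebesgue_measure]_(s in J t n)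
      (ipH (iota (derive1 w s)) (iota (v s)) + A s (w s) (v s))
  + ipH (iota (vplus t w 0)) (iota (vplus t v 0))
  + \sum_(1 <= n < N) ipH (iota (jump t w n)) (iota (vplus t v n)).

Definition int_normX ipH iota N t v : R :=
  \sum_(0 <= n < N) \int[lebesgue_measure]_(s in J t n)
    (dual_norm (to_dual ipH iota (iota (derive1 v s))) ^+ 2 + `|v s| ^+ 2).

Definition int_normY N t v : R :=
  \sum_(0 <= n < N) \int[lebesgue_measure]_(s in J t n) (`|v s| ^+ 2).

Definition jump_sum iota N t v : R :=
  \sum_(1 <= n < N) `|iota (jump t v n)| ^+ 2.

Definition weighted_sum iota N t v : R :=
  \sum_(1 <= n < N) step t n * `|iota (vplus t v n)| ^+ 2.

Definition normX ipH iota N t v : R :=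
  Num.sqrt (int_normX ipH iota N t v + `|iota (vplus t v 0)| ^+ 2
            + jump_sum iota N t v).

Definition normY iota N t v : R :=
  Num.sqrt (int_normY N t v + `|iota (vplus t v 0)| ^+ 2
            + weighted_sum iota N t v).

Definition tnormX ipH iota N t v : R :=
  Num.sqrt (int_normX ipH iota N t v + `|iota (v (t N))| ^+ 2
            + jump_sum iota N t v).

Definition tnormY iota N t v : R :=
  Num.sqrt (int_normY N t v + `|iota (v (t N))| ^+ 2
            + weighted_sum iota N t v).

End DG.

Definition inf_sup (R : realType) (F : Type) (S : set F)
    (B : F -> F -> R) (normW normV : F -> R) : \bar R :=
  ereal_inf [set ereal_sup [set (B w v / (normW w * normV v))%:E | v in S]
            | w in S].

(* Main.v *)
Require Import Defs.
From HB Require Import structures.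
From mathcomp Require Import all_boot all_order all_algebra.
From mathcomp Require Import sesquilinear.
From mathcomp Require Import all_classical all_reals all_analysis.
From mathcomp Require Import measurable_realfun polyrcf ring lra.

Set Implicit Arguments.
Unset Strict Implicit.
Unset Printing Implicit Defensive.

Import Order.TTheory GRing.Theory Num.Theory.
Import numFieldNormedType.Exports.

Local Open Scope classical_set_scope.
Local Open Scope ring_scope.

(** On a partition element of length tau, a function of the discrete space is a
    V-valued polynomial in x = (s - t_n) / tau, determined by q+1 coefficients.
    In these coordinates the bilinear form and the squares of the four norms are
    finite sums of integrals over [0, 1] of real polynomials, plus one term per
    element carrying the operator A, a bilinear, coercive and bounded form in the
    coefficients on that element.

    First inequality.  Testing with w itself gives the energy identity
      B(w, w) = int <A w, w> + (|w^N|^2 + |w^(0,+)|^2 + sum of |jump|^2) / 2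
    ([dg_form_energy]), which controls every term of the X-norm of w except the
    dual norm of w'.  For that one, let z be the Riesz representative of w' in V,
    so that (w', z) is the squared dual norm of w'; z is again a polynomial, of
    degree less than q.  Hence (s - t_n) z / tau is an admissible test function.
    It vanishes at the left node, so it meets no jump, and multiplying by the
    weight x costs only a factor depending on q ([vanishing_multiplier]).  A small
    multiple of it added to w gives v with B(w, v) >= c |w|_X^2 and
    |v|_Y <= C |w|_X ([stab_primal]).

    The factor depending on q comes from one inequality, [coef_bound]: the sum of
    the squared coefficients of a polynomial is bounded by the integral of
    x (1 - x) times its squared norm.  It is proved by inverting the weighted Gram
    matrix of the monomials, and holds with one constant in all inner product
    spaces.  It also bounds tau |v^(n,+)|^2 by the integral of |v|_V^2, which is
    where the embedding constant K enters.

    Second inequality, with the norms that contain the final value in place of the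
    initial one.  Integration by parts moves the derivative to v
    ([dg_form_by_parts]), and the same construction, with a factor vanishing at
    the right node instead, gives for every v some w with B(w, v) >= c |v|_X^2
    and |w|_Y <= C |v|_X ([stab_adjoint]).  This is an inf-sup estimate with the
    two arguments exchanged.  To exchange them back, given w, solve the adjoint
    problem B(phi, v) = (w, phi)_Y for all phi.  The form B is coercive and bounded
    on the Hilbert space of coefficient arrays, with constants depending on the
    partition, so a Lax-Milgram argument gives v up to an arbitrarily small
    residual ([lax_milgram_approx]); the exchanged estimate then bounds v by w
    uniformly in the partition ([adjoint_problem]).

    Finiteness holds because B(w, .) is bounded for each fixed w. *)

(** * Bilinear forms given as functions *)
Section Forms.
Context {R : realFieldType} {E : lmodType R}.
Implicit Types (b : E -> E -> R) (f : E -> R).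

(** A predicate on plain functions rather than a bundled structure: it has to
    apply to forms obtained by composition, summation and integration. *)
Definition bilin b : Prop := (forall u, scalar (b u)) /\ (forall v, scalar (b^~ v)).

Definition symf b : Prop := forall u v, b u v = b v u.
Definition psd b : Prop := forall u, 0 <= b u u.

Lemma scalar_fun0 f : scalar f -> f 0 = 0.
Proof.
move=> lf; have := lf 1 0 0; rewrite scale1r addr0 mul1r => /eqP.
by rewrite eq_sym -subr_eq0 addrK => /eqP.
Qed.

Lemma scalar_funZ f : scalar f -> forall k u, f (k *: u) = k * f u.
Proof. by move=> lf k u; rewrite -[k *: u]addr0 lf scalar_fun0 ?addr0. Qed.

Lemma scalar_funD f : scalar f -> forall u v, f (u + v) = f u + f v.
Proof. by move=> lf u v; rewrite -[u in LHS]scale1r lf mul1r. Qed.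

Lemma scalar_funN f : scalar f -> forall u, f (- u) = - f u.
Proof. by move=> lf u; rewrite -scaleN1r scalar_funZ// mulN1r. Qed.

Lemma scalar_funB f : scalar f -> forall u v, f (u - v) = f u - f v.
Proof. by move=> lf u v; rewrite scalar_funD// scalar_funN. Qed.

Lemma scalar_fun_sum f : scalar f -> forall I (r : seq I) (P : pred I) (F : I -> E),
  f (\sum_(i <- r | P i) F i) = \sum_(i <- r | P i) f (F i).
Proof. by move=> lf I r P F; elim/big_rec2: _ => [|i y1 y2 _ <-]; rewrite ?scalar_fun0 ?scalar_funD. Qed.

Section B.
Variables (b : E -> E -> R) (bl : bilin b).
Lemma bilDl u v w : b (u + v) w = b u w + b v w.
Proof. exact: (scalar_funD (bl.2 w)). Qed.
Lemma bilDr u v w : b w (u + v) = b w u + b w v.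
Proof. exact: (scalar_funD (bl.1 w)). Qed.
Lemma bilBl u v w : b (u - v) w = b u w - b v w.
Proof. exact: (scalar_funB (bl.2 w)). Qed.
Lemma bilBr u v w : b w (u - v) = b w u - b w v.
Proof. exact: (scalar_funB (bl.1 w)). Qed.
Lemma bilNl u w : b (- u) w = - b u w.
Proof. exact: (scalar_funN (bl.2 w)). Qed.
Lemma bilNr u w : b w (- u) = - b w u.
Proof. exact: (scalar_funN (bl.1 w)). Qed.
Lemma bilZl k u w : b (k *: u) w = k * b u w.
Proof. exact: (scalar_funZ (bl.2 w)). Qed.
Lemma bilZr k u w : b w (k *: u) = k * b w u.
Proof. exact: (scalar_funZ (bl.1 w)). Qed.
Lemma bil0l w : b 0 w = 0.
Proof. exact: (scalar_fun0 (bl.2 w)). Qed.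
Lemma bil0r w : b w 0 = 0.
Proof. exact: (scalar_fun0 (bl.1 w)). Qed.
Lemma bil_suml I (r : seq I) (P : pred I) (F : I -> E) w :
  b (\sum_(i <- r | P i) F i) w = \sum_(i <- r | P i) b (F i) w.
Proof. exact: (scalar_fun_sum (bl.2 w)). Qed.
Lemma bil_sumr I (r : seq I) (P : pred I) (F : I -> E) w :
  b w (\sum_(i <- r | P i) F i) = \sum_(i <- r | P i) b w (F i).
Proof. exact: (scalar_fun_sum (bl.1 w)). Qed.

Hypotheses (sb : symf b) (pb : psd b).

Lemma psd_young th u v : 0 < th -> 2 * b u v <= th * b u u + th^-1 * b v v.
Proof.
move=> th0; have := pb (th *: u - v).
rewrite bilBl !bilBr !bilZl !bilZr (sb v u) => h.
have : 0 <= th^-1 * (th * (th * b u u) - th * b u v - (th * b u v - b v v)).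
  by rewrite mulr_ge0// invr_ge0 ltW.
rewrite !mulrBr !mulrA mulVf ?gt_eqF// !mul1r; lra.
Qed.

(** The form need not be definite: if b v v = 0, then b (u - k v) (u - k v) is
    affine in k, and stays nonnegative only if b u v = 0. *)
Lemma psd_CS u v : b u v ^+ 2 <= b u u * b v v.
Proof.
have [v0|v0] := eqVneq (b v v) 0.
  suff -> : b u v = 0 by rewrite expr0n/= v0 mulr0.
  apply/eqP/negPn/negP => uv0.
  (* any k with k * b u v > b u u / 2 contradicts positivity *)
  pose k := (b u u + 1) / b u v.
  have := pb (u - k *: v).
  rewrite bilBl !bilBr !bilZl !bilZr (sb v u) v0 !mulr0 subr0.
  rewrite /k divfK// => h; have := pb u; lra.
have vp : 0 < b v v by rewrite lt_neqAle eq_sym v0 pb.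
have := pb (u - (b u v / b v v) *: v).
rewrite bilBl !bilBr !bilZl !bilZr (sb v u) divfK// subrr subr0.
rewrite subr_ge0 mulrAC ler_pdivrMr// -expr2; lra.
Qed.

Lemma psd_sqD u v : b (u + v) (u + v) <= 2 * b u u + 2 * b v v.
Proof.
have := pb (u - v); rewrite bilBl !bilBr bilDl !bilDr (sb v u); lra.
Qed.

End B.
End Forms.

(** * Integrals of polynomials over the unit interval *)
Section PolyIntegral.
Context {R : realType}.
Implicit Types (p q : {poly R}).

Definition antideriv p : {poly R} := \poly_(k < (size p).+1) (p`_k.-1 / k%:R).

Lemma deriv_antideriv p : (antideriv p)^`() = p.
Proof.
apply/polyP => k; rewrite coef_deriv coef_poly ltnS /=.
case: ltnP => [_|sk]; last by rewrite mul0rn nth_default.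
by rewrite -(mulr_natr (_ / _)) divfK// pnatr_eq0.
Qed.

(** Defined algebraically, so that linearity and integration by parts need no
    measure theory; [Rintegral_int01] identifies it with Lebesgue integrals. *)
Definition int01 p : R := (antideriv p).[1] - (antideriv p).[0].

Lemma deriv_eq0 p : p^`() = 0 -> p = (p`_0)%:P.
Proof.
move=> dp; apply/polyP => -[|k]; rewrite coefC//=.
move/polyP: dp => /(_ k); rewrite coef_deriv coef0 -mulr_natr => /eqP.
by rewrite mulf_eq0 pnatr_eq0 orbF => /eqP.
Qed.

Lemma int01_deriv p : int01 p^`() = p.[1] - p.[0].
Proof.
rewrite /int01; set P := antideriv _.
have : (P - p)^`() = 0 by rewrite derivB deriv_antideriv subrr.
move/deriv_eq0 => e; have -> : P = ((P - p)`_0)%:P + p by rewrite -e subrK.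
by rewrite !hornerD !hornerC; lra.
Qed.

Lemma int01_scalar : scalar int01.
Proof.
move=> k p q; rewrite -[X in k *: X]deriv_antideriv -[X in _ + X]deriv_antideriv.
rewrite -derivZ -derivD int01_deriv !hornerD !hornerZ /int01; lra.
Qed.

Lemma int01D p q : int01 (p + q) = int01 p + int01 q.
Proof. exact: (scalar_funD int01_scalar). Qed.
Lemma int01B p q : int01 (p - q) = int01 p - int01 q.
Proof. exact: (scalar_funB int01_scalar). Qed.
Lemma int01Z k p : int01 (k *: p) = k * int01 p.
Proof. exact: (scalar_funZ int01_scalar). Qed.
Lemma int01_sum I (r : seq I) (P : pred I) (F : I -> {poly R}) :
  int01 (\sum_(i <- r | P i) F i) = \sum_(i <- r | P i) int01 (F i).
Proof. exact: (scalar_fun_sum int01_scalar). Qed.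

Lemma int01_1 : int01 1 = 1.
Proof. by rewrite -(derivX R) int01_deriv !hornerX subr0. Qed.

(** Mean value theorem for the antiderivative. *)
Lemma antideriv_mono p (x y : R) : (forall z, 0 <= z <= 1 -> 0 <= p.[z]) ->
  0 <= x -> x <= y -> y <= 1 -> (antideriv p).[x] <= (antideriv p).[y].
Proof.
move=> p0 x0 xy y1; have [->//|neq] := eqVneq x y.
have ltxy : x < y by rewrite lt_neqAle neq.
have [c + e] := poly_mvt (antideriv p) ltxy.
rewrite in_itv/= => /andP[xc cy].
rewrite -subr_ge0 e deriv_antideriv mulr_ge0 ?subr_ge0// p0//.
by rewrite (le_trans x0 (ltW xc)) (le_trans (ltW cy) y1).
Qed.

Lemma int01_ge0 p : (forall z, 0 <= z <= 1 -> 0 <= p.[z]) -> 0 <= int01 p.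
Proof. by move=> p0; rewrite subr_ge0 antideriv_mono. Qed.

Lemma le_int01 p q : (forall z, 0 <= z <= 1 -> p.[z] <= q.[z]) -> int01 p <= int01 q.
Proof.
move=> pq; rewrite -subr_ge0 -int01B int01_ge0// => z z01.
by rewrite hornerD hornerN subr_ge0 pq.
Qed.

(** The points 1 / (k + 1), one more than the degree allows, are all roots. *)
Lemma poly_eq0_itv p : (forall z, 0 <= z <= 1 -> p.[z] = 0) -> p = 0.
Proof.
move=> p0; apply/eqP/negPn/negP => pN0.
pose s := [seq (k.+1%:R)^-1 : R | k <- iota 0 (size p)].
have := @max_poly_roots _ p s pN0.
rewrite size_map size_iota ltnn => h; apply: notF; apply: h.
  apply/allP => _ /mapP[k _ ->]; apply/rootP/p0.
  by rewrite invr_ge0 ler0n/= invf_le1 ?ltr0n// ler1n.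
rewrite map_inj_uniq ?iota_uniq// => i j /invr_inj /eqP.
by rewrite eqr_nat eqSS => /eqP.
Qed.

(** The antiderivative is monotone on [0, 1] and takes equal values at the ends,
    so it is constant there, hence constant as a polynomial. *)
Lemma int01_eq0 p : (forall z, 0 <= z <= 1 -> 0 <= p.[z]) -> int01 p = 0 -> p = 0.
Proof.
move=> p0 /eqP; rewrite subr_eq0 => /eqP e.
have : antideriv p - ((antideriv p).[0])%:P = 0.
  apply: poly_eq0_itv => z /andP[z0 z1].
  rewrite hornerD hornerN hornerC; apply/eqP; rewrite subr_eq0 eq_le.
  by rewrite -{1}e !antideriv_mono.
move/(congr1 (fun r : {poly R} => r^`())).
by rewrite derivB deriv_antideriv derivC subr0 raddf0.
Qed.

End PolyIntegral.

(** * Vector-valued polynomials of degree at most q *)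
Section Slab.
Context {R : realType} (q : nat).

Section SlabV.
Context {V : lmodType R}.
Implicit Types (b : V -> V -> R) (c d : nat -> V) (x : R).

(** Coefficients form a sequence indexed by nat, of which the first q+1 terms
    count; shifting indices in the derivative is then free of casts. *)
Definition peval c x : V := \sum_(i < q.+1) x ^+ i *: c i.

Definition pderiv c : nat -> V := fun i => if (i < q)%N then i.+1%:R *: c i.+1 else 0.

(** The real polynomial x |-> b (peval c x) (peval d x), see [pform_horner]. *)
Definition pform b c d : {poly R} :=
  \sum_(i < q.+1) \sum_(j < q.+1) b (c i) (d j) *: 'X^(i + j).

Lemma peval_lin k c d x : peval (k *: c + d) x = k *: peval c x + peval d x.
Proof.
rewrite /peval scaler_sumr -big_split/=; apply: eq_bigr => i _.
by rewrite !fctE scalerDr !scalerA mulrC.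
Qed.

Lemma peval0 c : peval c 0 = c 0%N.
Proof.
rewrite /peval big_ord_recl/= expr0 scale1r big1 ?addr0// => i _.
by rewrite expr0n/= scale0r.
Qed.

Lemma pform_horner b c d x : bilin b -> (pform b c d).[x] = b (peval c x) (peval d x).
Proof.
move=> bl; rewrite horner_sum (bil_suml bl); apply: eq_bigr => i _.
rewrite horner_sum (bilZl bl) (bil_sumr bl) mulr_sumr; apply: eq_bigr => j _.
by rewrite hornerZ hornerXn (bilZr bl) exprD mulrC mulrA.
Qed.

Lemma pform_bilin b : bilin b -> bilin (fun c d => int01 (pform b c d)).
Proof.
move=> bl; split=> c k d1 d2; rewrite -int01Z -int01D; congr int01;
  rewrite /pform scaler_sumr -big_split/=; apply: eq_bigr => i _;
  rewrite scaler_sumr -big_split/=; apply: eq_bigr => j _;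
  by rewrite !fctE ?(bl.1 (c i)) ?(bl.2 (c j)) scalerDl scalerA.
Qed.

(** Testing a vector-valued polynomial against a linear functional commutes with
    differentiation.  This is what the product rule [deriv_pform] needs of each
    of its two factors. *)
Lemma pderiv_poly f c : scalar f ->
  \sum_(i < q.+1) f (pderiv c i) *: 'X^i = \sum_(i < q.+1) f (c i) *: ('X^i)^`() :> {poly R}.
Proof.
move=> lf; rewrite big_ord_recr/= {2}/pderiv ltnn (scalar_fun0 lf) scale0r addr0.
rewrite [RHS]big_ord_recl/= expr0 derivC scaler0 add0r; apply: eq_bigr => i _.
rewrite /pderiv ltn_ord (scalar_funZ lf) derivXn/=.
by rewrite -scalerMnr scalerMnl mulr_natl.
Qed.

Lemma peval_der c x : peval (pderiv c) x = \sum_(i < q.+1) (i%:R * x ^+ i.-1) *: c i.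
Proof.
rewrite /peval big_ord_recr/= {2}/pderiv ltnn scaler0 addr0.
rewrite [RHS]big_ord_recl/= mul0r scale0r add0r; apply: eq_bigr => i _.
by rewrite /pderiv ltn_ord scalerA mulrC.
Qed.

Lemma pform_suml b c d : pform b c d =
  \sum_(j < q.+1) (\sum_(i < q.+1) b (c i) (d j) *: 'X^i) * 'X^j.
Proof.
rewrite /pform exchange_big/=; apply: eq_bigr => j _; rewrite mulr_suml.
by apply: eq_bigr => i _; rewrite -scalerAl exprD.
Qed.

Lemma pform_sumr b c d : pform b c d =
  \sum_(i < q.+1) 'X^i * (\sum_(j < q.+1) b (c i) (d j) *: 'X^j).
Proof.
apply: eq_bigr => j _; rewrite mulr_sumr.
by apply: eq_bigr => i _; rewrite -scalerAr exprD.
Qed.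

Lemma deriv_pform b c d : bilin b ->
  (pform b c d)^`() = pform b (pderiv c) d + pform b c (pderiv d).
Proof.
move=> bl; rewrite [X in _ = X + _]pform_suml [X in _ = _ + X]pform_sumr.
under [X in _ = X + _]eq_bigr => j _ do
  rewrite (pderiv_poly _ (bl.2 (d j))) mulr_suml.
under [X in _ = _ + X]eq_bigr => i _ do
  rewrite (pderiv_poly _ (bl.1 (c i))) mulr_sumr.
rewrite exchange_big/= raddf_sum/= -big_split/=; apply: eq_bigr => i _.
rewrite raddf_sum/= -big_split/=; apply: eq_bigr => j _.
by rewrite derivZ exprD derivM scalerDr -scalerAl -scalerAr.
Qed.

Lemma int01_by_parts b c d : bilin b ->
  int01 (pform b (pderiv c) d) + int01 (pform b c (pderiv d)) =
  b (peval c 1) (peval d 1) - b (peval c 0) (peval d 0).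
Proof. by move=> bl; rewrite -int01D -deriv_pform// int01_deriv !pform_horner. Qed.

Lemma pform_sym b c d : symf b -> pform b c d = pform b d c.
Proof.
move=> sb; rewrite /pform exchange_big/=; apply: eq_bigr => i _.
by apply: eq_bigr => j _; rewrite sb addnC.
Qed.

Lemma int01_pderiv_self b c : bilin b -> symf b ->
  int01 (pform b (pderiv c) c) = 2^-1 * (b (peval c 1) (peval c 1) - b (peval c 0) (peval c 0)).
Proof. by move=> bl sb; have := int01_by_parts c c bl; rewrite (pform_sym _ (pderiv c) sb); lra. Qed.

(** The square of a norm on polynomials that does not depend on any interval. *)
Definition coef_sq b c : R := \sum_(i < q.+1) b (c i) (c i).

Lemma coef_sq_ge0 b c : psd b -> 0 <= coef_sq b c.
Proof. by move=> pb; apply: sumr_ge0 => i _. Qed.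

Lemma peval_le b c x : bilin b -> symf b -> psd b -> 0 <= x <= 1 ->
  b (peval c x) (peval c x) <= q.+1%:R * coef_sq b c.
Proof.
move=> bl sb pb /andP[x0 x1].
rewrite (bil_suml bl); under eq_bigr => i _ do rewrite (bil_sumr bl).
apply: (@le_trans _ _ (\sum_(i < q.+1) \sum_(j < q.+1)
   (2^-1 * (b (c i) (c i)) + 2^-1 * (b (c j) (c j))))).
  apply: ler_sum => i _; apply: ler_sum => j _.
  rewrite (bilZl bl) (bilZr bl) mulrA -exprD.
  have := psd_young bl sb pb (c i) (c j) (@ltr01 R); rewrite invr1 !mul1r => h.
  have := pb (c i); have := pb (c j) => h1 h2.
  have y0 : 0 <= x ^+ (i + j) by rewrite exprn_ge0.
  have y1 : x ^+ (i + j) <= 1 by rewrite exprn_ile1.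
  nra.
under eq_bigr => i _ do rewrite big_split/= sumr_const card_ord.
rewrite big_split/= sumr_const card_ord sumrMnl -!mulr_sumr -/(coef_sq b c).
by rewrite -[_ *+ _]mulr_natl; lra.
Qed.

End SlabV.
End Slab.

(** ** Coefficients are bounded by a weighted mean square *)
Section KeyBound.
Context {R : realType} (q : nat).

(** One weight below both x and 1 - x on [0, 1], to serve for multipliers
    vanishing at either end. *)
Let om : {poly R} := 'X * (1 - 'X).

Let om_ge0 x : 0 <= x <= 1 -> 0 <= om.[x].
Proof.
by move=> /andP[x0 x1]; rewrite hornerM hornerD hornerN hornerC hornerX mulr_ge0// subr_ge0.
Qed.

Let G : 'M[R]_q.+1 := \matrix_(i, j) int01 (om * 'X^(i + j)).

(** If v G = 0 and p has coefficients v, then v G v^T is the integral of om p^2,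
    so p = 0. *)
Let G_unit : G \in unitmx.
Proof.
rewrite -row_free_unit; apply: inj_row_free => v vG.
pose p : {poly R} := \poly_(i < q.+1) v 0 (inord i).
have pE : p = \sum_(i < q.+1) v 0 i *: 'X^i.
  by rewrite /p poly_def; apply: eq_bigr => i _; rewrite inord_val.
have : int01 (om * p ^+ 2) = 0.
  transitivity ((v *m G *m v^T) 0 0); last by rewrite vG mul0mx mxE.
  rewrite mxE expr2 mulrA {2}pE mulr_sumr int01_sum; apply: eq_bigr => j _.
  rewrite !mxE mulr_suml pE mulr_sumr mulr_suml int01_sum; apply: eq_bigr => i _.
  rewrite !mxE -!scalerAr -!scalerAl !int01Z.
  by rewrite exprD [om * (_ * _)]mulrA [LHS]mulrC -[LHS]mulrA.
move/int01_eq0 => h; have {h} : om * p ^+ 2 = 0.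
  by apply: h => z z01; rewrite hornerM horner_exp mulr_ge0 ?om_ge0// sqr_ge0.
move/eqP; rewrite mulf_eq0 expf_eq0/= /om mulf_eq0 polyX_eq0/=.
rewrite subr_eq0 => /orP[/eqP/(congr1 (fun r : {poly R} => r.[0]))|/eqP p0].
  by rewrite hornerC hornerX => /eqP; rewrite oner_eq0.
apply/rowP => i; have := congr1 (fun r : {poly R} => r`_i) p0.
by rewrite coef_poly ltn_ord inord_val coef0 mxE.
Qed.

(** The basis dual to the monomials for the weight om: integrating against
    om * ell i extracts the i-th coefficient. *)
Let ell (i : 'I_q.+1) : {poly R} := \sum_(k < q.+1) (invmx G) i k *: 'X^k.

Let ellP i (j : 'I_q.+1) : int01 (om * ell i * 'X^j) = (i == j)%:R.
Proof.
have := mulVmx G_unit => /matrixP/(_ i j); rewrite !mxE => <-.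
rewrite mulr_sumr mulr_suml int01_sum; apply: eq_bigr => k _.
by rewrite !mxE -scalerAr -scalerAl int01Z -mulrA -exprD.
Qed.

(** Extract c_i by ell_i, pair with c_i itself and apply Young's inequality under
    the integral: 2 |c_i|^2 <= L Q + |c_i|^2 (L - 1) / L, where Q is the weighted
    integral and L - 1 that of ell_i^2.  The polynomials ell_i depend on q only,
    hence so does the constant: it is chosen before the space V. *)
Lemma coef_bound : exists2 C0 : R, 1 <= C0 &
  forall (V : lmodType R) (b : V -> V -> R), bilin b -> symf b -> psd b ->
  forall c : nat -> V, coef_sq q b c <= C0 * int01 (om * pform q b c c).
Proof.
pose L i := int01 (om * ell i ^+ 2) + 1.
have L1 i : 1 <= L i.
  rewrite lerDr int01_ge0// => z z01.
  by rewrite hornerM horner_exp mulr_ge0 ?om_ge0// sqr_ge0.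
exists (\sum_i L i).
  rewrite big_ord_recl; apply: (le_trans (L1 ord0)).
  by rewrite lerDl sumr_ge0// => i _; exact: (le_trans ler01 (L1 _)).
move=> V b bl sb pb c; rewrite mulr_suml; apply: ler_sum => i _.
have Lp : 0 < L i by rewrite (lt_le_trans ltr01).
pose P : {poly R} := \sum_(j < q.+1) b (c j) (c i) *: 'X^j.
have PE : b (c i) (c i) = int01 (om * ell i * P).
  rewrite mulr_sumr int01_sum (bigD1 i)//= big1 ?addr0 => [|j ji].
    by rewrite -scalerAr int01Z ellP eqxx mulr1.
  by rewrite -scalerAr int01Z ellP eq_sym (negbTE ji) mulr0.
have Px x : P.[x] = b (peval q c x) (c i).
  rewrite (bil_suml bl) horner_sum; apply: eq_bigr => j _.
  by rewrite hornerZ hornerXn (bilZl bl) mulrC.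
set Q := int01 (om * pform q b c c).
have : 2 * b (c i) (c i) <= L i * Q + (L i)^-1 * ((L i - 1) * b (c i) (c i)).
  rewrite [X in 2 * X]PE -int01Z [L i - 1]addrK mulrA -[_ * b _ _]mulrC mulrA.
  rewrite -!int01Z -int01D; apply: le_int01 => z z01.
  rewrite hornerD !hornerZ !hornerM (Px z) pform_horner//.
  have := psd_young bl sb pb (peval q c z) ((ell i).[z] *: c i) Lp.
  rewrite !(bilZr bl) (bilZl bl) => /(ler_wpM2l (om_ge0 z01)); rewrite hornerM; lra.
have -> : (L i)^-1 * ((L i - 1) * b (c i) (c i)) = b (c i) (c i) - (L i)^-1 * b (c i) (c i).
  by field; rewrite gt_eqF.
move=> h.
have h0 : 0 <= (L i)^-1 * b (c i) (c i) by rewrite mulr_ge0// invr_ge0 ltW.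
lra.
Qed.

End KeyBound.

(** * Approximate solution of coercive problems *)

(** Converse of Young's inequality: optimizing over th recovers the product
    bound.  The optimum used is th = |x| / a, which avoids square roots. *)
Lemma young_sq (R : realFieldType) (x a b : R) : 0 <= a -> 0 <= b ->
  (forall th, 0 < th -> 2 * `|x| <= th * a + th^-1 * b) -> x ^+ 2 <= a * b.
Proof.
move=> a0 b0 H; have [->|xN0] := eqVneq x 0; first by rewrite expr0n mulr_ge0.
have x0 : 0 < `|x| by rewrite normr_gt0.
move: a0; rewrite le_eqVlt => /orP[/eqP a0|a0].
  have := H ((b + 1) / `|x|); rewrite divr_gt0 ?ltr_wpDl// => /(_ isT).
  rewrite -a0 mulr0 add0r invf_div -mulrA mulrCA => h.
  suff : `|x| * ((b + 1)^-1 * b) <= `|x| by lra.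
  by rewrite ger_pMr// mulrC ler_pdivrMr ?ltr_wpDl// mul1r lerDl.
have := H (`|x| / a); rewrite divr_gt0// => /(_ isT).
rewrite divfK ?gt_eqF// invf_div => h.
have {}h : `|x| <= a / `|x| * b by lra.
rewrite -real_normK ?num_real// expr2 -ler_pdivlMr// mulrAC; lra.
Qed.

(** Residual iteration: if e represents f - b(., v), replace v by v + (c / B) e.
    Coercivity and boundedness make the squared norm of the residual shrink by
    the factor 1 - c^2 / B, where B exceeds c^2.  The iterates stay in E for any
    E in which bounded functionals are representable, complete or not, which is
    why the solution is approximate. *)
Lemma lax_milgram_approx (R : archiRealFieldType) (E : lmodType R) (s b : E -> E -> R)
    (beta c : R) : bilin s -> symf s -> psd s -> bilin b ->
  (forall u v, b u v ^+ 2 <= beta * (s u u * s v v)) ->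
  0 < c -> (forall u, c * s u u <= b u u) ->
  (forall f, scalar f -> (exists L, forall u, f u ^+ 2 <= L * s u u) ->
     exists r, forall u, f u = s r u) ->
  forall f, scalar f -> (exists L, forall u, f u ^+ 2 <= L * s u u) ->
  forall eps, 0 < eps ->
  exists v e, (forall u, f u - b u v = s e u) /\ s e e <= eps.
Proof.
move=> sl ss sp bl bb c0 bc riesz f fl fL eps eps0.
have [r rP] := riesz f fl fL.
pose B := `|beta| + 1 + c ^+ 2.
have c20 : 0 < c ^+ 2 by rewrite exprn_gt0.
have B0 : 0 < B by rewrite /B; have := normr_ge0 beta; lra.
have cB : c ^+ 2 < B by rewrite /B; have := normr_ge0 beta; lra.
have {}bb u v : b u v ^+ 2 <= B * (s u u * s v v).
  apply: (le_trans (bb u v)); apply: ler_wpM2r; first by rewrite mulr_ge0.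
  by rewrite /B; have := ler_norm beta; lra.
pose k := c ^+ 2 / B.
have k0 : 0 < k by rewrite divr_gt0.
have k1 : k < 1 by rewrite ltr_pdivrMr// mul1r.
(* (1 - k)^n is bounded by 1 / (1 + n k), which needs no limit of powers *)
have step n : exists v e, (forall u, f u - b u v = s e u) /\
    (1 + n%:R * k) * s e e <= s r r.
  elim: n => [|n [v [e [eP eB]]]].
    exists 0, r; split; last by rewrite mul0r addr0 mul1r.
    by move=> u; rewrite (bil0r bl) subr0 rP.
  have [y yP] : exists y, forall u, b u e = s y u.
    apply: (riesz (b^~ e) (bl.2 e)); exists (B * s e e) => u.
    by rewrite -mulrA [s e e * _]mulrC.
  exists (v + (c / B) *: e), (e - (c / B) *: y); split.
    move=> u; rewrite (bilDr bl) (bilZr bl) (bilBl sl) (bilZl sl) -eP -yP; lra.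
  have ye : s y e = b e e by rewrite -yP.
  have yy : s y y <= B * s e e.
    have [y0|yN] := eqVneq (s y y) 0; first by rewrite y0 mulr_ge0// ltW.
    have yp : 0 < s y y by rewrite lt_neqAle eq_sym yN sp.
    have := bb y e; rewrite yP expr2 mulrCA ler_pM2l//; lra.
  have E1 : s (e - (c / B) *: y) (e - (c / B) *: y) <= (1 - k) * s e e.
    rewrite (bilBl sl) !(bilBr sl) !(bilZl sl) !(bilZr sl) (ss e y) ye.
    have cB0 : 0 <= c / B by rewrite ltW// divr_gt0.
    have h1 := ler_wpM2l cB0 (bc e).
    have h2 := ler_wpM2l cB0 (ler_wpM2l cB0 yy).
    have e1 : c / B * (c * s e e) = k * s e e by rewrite /k; ring.
    have e2 : c / B * (c / B * (B * s e e)) = k * s e e.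
      by rewrite /k; field; rewrite gt_eqF.
    by move: h1 h2; rewrite e1 e2; lra.
  have n0 : 0 <= n.+1%:R * k by rewrite mulr_ge0// ltW.
  apply: (le_trans _ eB).
  have m0 : 0 <= 1 + n.+1%:R * k by rewrite addr_ge0.
  apply: (le_trans (ler_wpM2l m0 E1)); rewrite mulrA; apply: ler_wpM2r => //.
  have : 0 <= n.+1%:R * k * k by rewrite mulr_ge0// ltW.
  by rewrite -natr1; lra.
pose n := Num.bound (s r r / (k * eps)).
have [v [e [eP eB]]] := step n; exists v, e; split => //.
have : s r r / (k * eps) < n%:R by rewrite archi_boundP// divr_ge0// mulr_ge0 ?ltW.
rewrite ltr_pdivrMr; last exact: mulr_gt0. rewrite mulrA => h.
have nk : 0 < n%:R * k.
  by rewrite -(pmulr_lgt0 _ eps0) (le_lt_trans _ h).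
rewrite -(ler_pM2l nk); have := sp e; lra.
Qed.

(** * Arrays of coefficients *)

(** An array C holds in C n i, for n < N and i <= q, the i-th coefficient on the
    n-th element. *)
Section Arrays.
Context {R : realType} {V : lmodType R}.
Variables (g : V -> V -> R) (q N : nat).
Hypotheses (gl : bilin g) (gs : symf g) (gp : psd g).
Implicit Types (C D : nat -> nat -> V) (L : (nat -> nat -> V) -> V)
  (b : (nat -> nat -> V) -> (nat -> nat -> V) -> R).

Definition array_dot C D : R := \sum_(0 <= n < N) \sum_(i < q.+1) g (C n i) (D n i).

Lemma array_dot_bilin : bilin array_dot.
Proof.
split=> C k D1 D2; rewrite /array_dot mulr_sumr -big_split/=; apply: eq_bigr => n _;
  rewrite mulr_sumr -big_split/=; apply: eq_bigr => i _.
  by rewrite !fctE gl.1.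
by rewrite !fctE gl.2.
Qed.

Lemma array_dot_sym : symf array_dot.
Proof. by move=> C D; apply: eq_bigr => n _; apply: eq_bigr => i _. Qed.

Lemma array_dot_ge0 : psd array_dot.
Proof. by move=> C; apply: sumr_ge0 => n _; apply: sumr_ge0 => i _. Qed.

(** The forms of the discrete problem are sums of many terms, each bounded for
    the inner product above.  This predicate and [bdd_form] let boundedness be
    read off the shape of the terms; the constants may depend on the partition. *)
Definition bdd_lin L : Prop :=
  (forall k C D, L (k *: C + D) = k *: L C + L D) /\
  exists2 beta, 0 <= beta & forall C, g (L C) (L C) <= beta * array_dot C C.

Lemma bdd_lin_coord n i : (n < N)%N -> (i < q.+1)%N -> bdd_lin (fun C => C n i).
Proof.
move=> nN iq; split=> //; exists 1 => // C; rewrite mul1r.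
rewrite /array_dot big_mkord (bigD1 (Ordinal nN))//= (bigD1 (Ordinal iq))//= -addrA.
rewrite lerDl addr_ge0//; first by apply: sumr_ge0.
by apply: sumr_ge0 => m _; apply: sumr_ge0.
Qed.

Lemma bdd_lin0 : bdd_lin (fun=> 0).
Proof.
split=> [k _ _|]; first by rewrite scaler0 addr0.
by exists 0 => // C; rewrite (bil0l gl) mul0r.
Qed.

Lemma bdd_linD L L' : bdd_lin L -> bdd_lin L' -> bdd_lin (fun C => L C + L' C).
Proof.
move=> [l [B B0 BP]] [l' [B' B0' BP']]; split=> [k C D|].
  by rewrite l l' scalerDr addrACA.
exists (2 * B + 2 * B'); first by rewrite addr_ge0// mulr_ge0.
move=> C; apply: (le_trans (psd_sqD gl gs gp _ _)).
by have := BP C; have := BP' C; lra.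
Qed.

Lemma bdd_linZ a L : bdd_lin L -> bdd_lin (fun C => a *: L C).
Proof.
move=> [l [B B0 BP]]; split=> [k C D|].
  by rewrite l scalerDr !scalerA mulrC.
exists (a ^+ 2 * B); first by rewrite mulr_ge0// sqr_ge0.
move=> C; rewrite (bilZl gl) (bilZr gl) mulrA -expr2 -[leRHS]mulrA.
by apply: ler_wpM2l => //; exact: sqr_ge0.
Qed.

Lemma bdd_lin_sum (I : finType) (F : I -> (nat -> nat -> V) -> V) :
  (forall i, bdd_lin (F i)) -> bdd_lin (fun C => \sum_i F i C).
Proof.
move=> HF; elim: (index_enum I) => [|i r IH].
  rewrite (_ : (fun C => _) = fun=> 0); first exact: bdd_lin0.
  by apply/funext => C; rewrite big_nil.
rewrite (_ : (fun C => _) = fun C => F i C + \sum_(j <- r) F j C).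
  exact: bdd_linD.
by apply/funext => C; rewrite big_cons.
Qed.

Lemma bdd_lin_peval n x : (n < N)%N -> bdd_lin (fun C => peval q (C n) x).
Proof. by move=> nN; apply: bdd_lin_sum => i; apply: bdd_linZ; exact: bdd_lin_coord. Qed.

Lemma bdd_lin_pderiv n i : (n < N)%N -> bdd_lin (fun C => pderiv q (C n) i).
Proof.
move=> nN; rewrite /pderiv; have [iq|iq] := boolP (i < q)%N; last exact: bdd_lin0.
exact/bdd_linZ/bdd_lin_coord.
Qed.

Definition bdd_form b : Prop := bilin b /\
  exists2 beta, 0 <= beta & forall C D, b C D ^+ 2 <= beta * (array_dot C C * array_dot D D).

Lemma bdd_form0 : bdd_form (fun _ _ => 0).
Proof.
split; first by split=> C k D E; rewrite mulr0 addr0.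
by exists 0 => // C D; rewrite mul0r expr0n.
Qed.

Lemma bdd_formD b b' : bdd_form b -> bdd_form b' ->
  bdd_form (fun C D => b C D + b' C D).
Proof.
move=> [l [B B0 BP]] [l' [B' B0' BP']]; split.
  by split=> C k D E; rewrite ?(l.1 C) ?(l.2 C) ?(l'.1 C) ?(l'.2 C); ring.
exists (2 * B + 2 * B'); first by rewrite addr_ge0// mulr_ge0.
move=> C D; have := BP C D; have := BP' C D; have := sqr_ge0 (b C D - b' C D); lra.
Qed.

Lemma bdd_formZ a b : bdd_form b -> bdd_form (fun C D => a * b C D).
Proof.
move=> [l [B B0 BP]]; split.
  by split=> C k D E; rewrite ?(l.1 C) ?(l.2 C); ring.
exists (a ^+ 2 * B); first by rewrite mulr_ge0// sqr_ge0.
move=> C D; rewrite exprMn -[leRHS]mulrA; apply: ler_wpM2l => //; exact: sqr_ge0.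
Qed.

Lemma bdd_form_sum (I : eqType) (r : seq I) (F : I -> (nat -> nat -> V) -> (nat -> nat -> V) -> R) :
  (forall i, i \in r -> bdd_form (F i)) -> bdd_form (fun C D => \sum_(i <- r) F i C D).
Proof.
elim: r => [|i r IH] HF.
  rewrite (_ : (fun C D => _) = fun _ _ => 0); first exact: bdd_form0.
  by apply/funext => C; apply/funext => D; rewrite big_nil.
rewrite (_ : (fun C D => _) = fun C D => F i C D + \sum_(j <- r) F j C D).
  apply: bdd_formD; first by apply: HF; rewrite mem_head.
  by apply: IH => j jr; apply: HF; rewrite in_cons jr orbT.
by apply/funext => C; apply/funext => D; rewrite big_cons.
Qed.

Lemma bdd_form_lin (k : V -> V -> R) kap L L' : bilin k -> 0 <= kap ->
  (forall u v, k u v ^+ 2 <= kap * (g u u * g v v)) ->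
  bdd_lin L -> bdd_lin L' -> bdd_form (fun C D => k (L C) (L' D)).
Proof.
move=> kl kap0 kP [l [B B0 BP]] [l' [B' B0' BP']]; split.
  by split=> C a D E; rewrite ?l ?l' ?(kl.1 (L C)) ?(kl.2 (L' C)).
exists (kap * (B * B')); first by rewrite !mulr_ge0.
move=> C D; apply: (le_trans (kP _ _)); rewrite -mulrA; apply: ler_wpM2l => //.
by rewrite mulrACA; apply: ler_pM.
Qed.

Definition single (n i : nat) (u : V) : nat -> nat -> V :=
  fun m j => if (m == n) && (j == i) then u else 0.

Lemma single_lin n i k u v : single n i (k *: u + v) = k *: single n i u + single n i v.
Proof.
apply/funext => m; apply/funext => j; rewrite !fctE /single.
by case: ifP => // _; rewrite scaler0 addr0.
Qed.

Lemma array_dot_single n i u D : (n < N)%N -> (i < q.+1)%N -> array_dot (single n i u) D = g u (D n i).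
Proof.
move=> nN iq; rewrite /array_dot big_mkord (bigD1 (Ordinal nN))//= (bigD1 (Ordinal iq))//=.
rewrite /single !eqxx/= !big1 ?addr0//.
  move=> m; rewrite -val_eqE/= => /negbTE mn; rewrite big1// => j _.
  by rewrite mn/= (bil0l gl).
by move=> j; rewrite -val_eqE/= => /negbTE ->; rewrite (bil0l gl).
Qed.

(** Represent the functional on each coordinate separately.  The entries with
    n >= N or i > q do not contribute to a bounded functional, because the array
    C - C' built below is orthogonal to everything. *)
Lemma riesz_arrays : (forall f : V -> R, scalar f ->
    (exists B, forall u, f u ^+ 2 <= B * g u u) -> exists r, forall u, f u = g r u) ->
  forall f : (nat -> nat -> V) -> R, scalar f ->
    (exists B, forall C, f C ^+ 2 <= B * array_dot C C) -> exists r, forall C, f C = array_dot r C.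
Proof.
move=> riesz f fl [B fB].
have [r rP] : exists r : nat * nat -> V, forall p, (p.1 < N)%N -> (p.2 < q.+1)%N ->
    forall u, f (single p.1 p.2 u) = g (r p) u.
  suff /boolp.choice[r rP] : forall p : nat * nat, exists v : V,
      (p.1 < N)%N -> (p.2 < q.+1)%N -> forall u, f (single p.1 p.2 u) = g v u.
    by exists r.
  move=> [n i]/=; have [nN|] := boolP (n < N)%N; last by exists 0.
  have [iq|] := boolP (i < q.+1)%N; last by exists 0.
  have [||v vP] := riesz (fun u => f (single n i u)); last by exists v.
    by move=> k u v; rewrite single_lin fl.
  exists B => u; apply: (le_trans (fB _)).
  by rewrite array_dot_single// /single !eqxx.
exists (fun n i => r (n, i)) => C.
pose C' : nat -> nat -> V := \sum_(0 <= n < N) \sum_(i < q.+1) single n i (C n i).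
have -> : array_dot (fun n i => r (n, i)) C = f C'.
  rewrite (scalar_fun_sum fl); apply: eq_big_nat => n /andP[_ nN].
  by rewrite (scalar_fun_sum fl); apply: eq_bigr => i _; rewrite (rP (n, nat_of_ord i) nN (ltn_ord i)).
have C0 E : array_dot (C - C') E = 0.
  apply/eqP; rewrite (bilBl array_dot_bilin) subr_eq0; apply/eqP.
  rewrite [RHS](bil_suml array_dot_bilin); apply: eq_big_nat => n /andP[_ nN].
  by rewrite (bil_suml array_dot_bilin); apply: eq_bigr => i _; rewrite array_dot_single.
have := fB (C - C'); rewrite C0 mulr0 (scalar_funB fl) => h.
by apply/eqP; rewrite -subr_eq0 -sqrf_eq0 eq_le h sqr_ge0.
Qed.

End Arrays.

(** * The discrete problem in coefficients *)

(** With e and f the values at the right and left ends of the elements, this is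
    the summation by parts behind the energy identity and the adjoint form. *)
Lemma telescope_sum {R : realType} (e f : nat -> R) N :
  \sum_(0 <= n < N.+1) (e n - f n) + f 0%N + \sum_(1 <= n < N.+1) (f n - e n.-1) = e N.
Proof.
elim: N => [|N IH]; first by rewrite big_nat1 big_geq// addr0 subrK.
by rewrite big_nat_recr//= [X in _ + _ + X]big_nat_recr//=; move: IH; lra.
Qed.

(** Here g and h stand for the inner products of V and H on V, rho for the map
    sending u to the representative in V of the functional h u, tau n for the
    length of the n-th element and a n for its contribution from the operator.
    The hypothesis on a n is the bound M |c| |d| in the form of Young's
    inequality, which is how it is obtained and how it is used. *)
Section Discrete.
Context {R : realType} (q : nat) {V : lmodType R}.
Variables (g h : V -> V -> R) (rho : V -> V) (alpha M K C0 : R).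
Hypotheses (alpha_gt0 : 0 < alpha) (M_gt0 : 0 < M) (C0_ge1 : 1 <= C0).
Hypotheses (gl : bilin g) (gs : symf g) (gp : psd g).
Hypotheses (hl : bilin h) (hs : symf h) (hp : psd h).
Hypothesis hK : forall u, h u u <= K ^+ 2 * g u u.
Hypothesis rho_lin : forall k u v, rho (k *: u + v) = k *: rho u + rho v.
Hypothesis rhoP : forall u v, g (rho u) v = h u v.
Hypothesis C0P : forall c : nat -> V,
  coef_sq q g c <= C0 * int01 ('X * (1 - 'X) * pform q g c c).
Variables (N : nat) (tau : nat -> R) (a : nat -> (nat -> V) -> (nat -> V) -> R).
Hypothesis N_gt0 : (0 < N)%N.
Hypothesis tau_gt0 : forall n, (n < N)%N -> 0 < tau n.
Hypothesis a_bilin : forall n, (n < N)%N -> bilin (a n).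

Notation ev := (peval q).
Notation der := (pderiv q).
Notation pr := (pform q).
Notation sq c := (int01 (pr g c c)).

Hypothesis a_coer : forall n c, (n < N)%N -> alpha * (tau n * sq c) <= a n c c.
Hypothesis a_bnd : forall n c d th, (n < N)%N -> 0 < th ->
  2 * `|a n c d| <= M * (th * (tau n * sq c) + th^-1 * (tau n * sq d)).

(** Differentiation and rho commute, so this is the polynomial whose pointwise
    V-norm is the dual norm of the derivative ([peval_riesz_deriv]). *)
Definition riesz_deriv (c : nat -> V) : nat -> V := der (rho \o c).

Definition dg_form (C D : nat -> nat -> V) : R :=
  \sum_(0 <= n < N) (int01 (pr h (der (C n)) (D n)) + a n (C n) (D n))
  + h (C 0%N 0%N) (D 0%N 0%N)
  + \sum_(1 <= n < N) h (C n 0%N - ev (C n.-1) 1) (D n 0%N).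

(** The factor 1 / tau is what remains of tau^-2 from differentiating in
    (s - t_n) / tau and tau from the change of variables. *)
Definition int_X (C : nat -> nat -> V) : R := \sum_(0 <= n < N)
  ((tau n)^-1 * sq (riesz_deriv (C n)) + tau n * sq (C n)).

Definition int_Y (C : nat -> nat -> V) : R := \sum_(0 <= n < N) tau n * sq (C n).

Definition jumps (C : nat -> nat -> V) : R := \sum_(1 <= n < N)
  h (C n 0%N - ev (C n.-1) 1) (C n 0%N - ev (C n.-1) 1).

Definition weighted (C : nat -> nat -> V) : R :=
  \sum_(1 <= n < N) tau n * h (C n 0%N) (C n 0%N).

Definition initial (C : nat -> nat -> V) : R := h (C 0%N 0%N) (C 0%N 0%N).
Definition final (C : nat -> nat -> V) : R := h (ev (C N.-1) 1) (ev (C N.-1) 1).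

Let C0_gt0 : 0 < C0. Proof. exact: lt_le_trans ltr01 C0_ge1. Qed.

Lemma rho0 : rho 0 = 0.
Proof. by have := rho_lin 1 0 0; rewrite !scale1r addr0 => /eqP; rewrite -subr_eq0 opprD addrA subrr add0r oppr_eq0 => /eqP. Qed.

Lemma rhoZ k u : rho (k *: u) = k *: rho u.
Proof. by rewrite -[k *: u]addr0 rho_lin rho0 addr0. Qed.

Lemma rhoD u v : rho (u + v) = rho u + rho v.
Proof. by have := rho_lin 1 u v; rewrite !scale1r. Qed.

Lemma riesz_derivE c i : riesz_deriv c i = rho (der c i).
Proof. by rewrite /riesz_deriv /pderiv; case: ifP; rewrite ?rho0 ?rhoZ. Qed.

Lemma peval_riesz_deriv c x : ev (riesz_deriv c) x = rho (ev (der c) x).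
Proof.
rewrite [RHS](big_morph rho rhoD rho0); apply: eq_bigr => i _.
by rewrite rhoZ riesz_derivE.
Qed.

Lemma sq_ge0 c : 0 <= sq c.
Proof. by apply: int01_ge0 => x _; rewrite pform_horner. Qed.

Lemma sq_le c : sq c <= q.+1%:R * coef_sq q g c.
Proof.
rewrite -[leRHS]mulr1 -[X in _ * X]int01_1 -int01Z; apply: le_int01 => x x01.
rewrite pform_horner// hornerZ hornerC mulr1. exact: peval_le.
Qed.

Lemma om_le_sq c : int01 ('X * (1 - 'X) * pr g c c) <= sq c.
Proof.
apply: le_int01 => x /andP[x0 x1].
rewrite hornerM pform_horner// !hornerE; have := gp (ev c x); nra.
Qed.

Lemma coef_sq_le c : coef_sq q g c <= C0 * sq c.
Proof. by rewrite (le_trans (C0P c))// ler_wpM2l ?om_le_sq// ltW. Qed.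

Lemma trace_le c x : 0 <= x <= 1 -> h (ev c x) (ev c x) <= K ^+ 2 * q.+1%:R * C0 * sq c.
Proof.
move=> x01; apply: (le_trans (hK _)); rewrite -(mulrA (K ^+ 2)) -(mulrA (K ^+ 2)).
apply: ler_wpM2l; first exact: sqr_ge0.
apply: (le_trans (peval_le q _ gl gs gp x01)); rewrite -mulrA.
by apply: ler_wpM2l; [exact: ler0n|exact: coef_sq_le].
Qed.

(** The fraction of the mean square of a polynomial that survives multiplication
    by a weight bounded below by x (1 - x). *)
Definition delta := (C0 * q.+1%:R)^-1.
Lemma delta_gt0 : 0 < delta.
Proof. by rewrite invr_gt0 mulr_gt0// ltr0n. Qed.

(** The reason for the whole construction: multiplying the representative of the
    derivative, of degree q-1, by x or 1 - x stays in degree q and kills one end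
    value, chosen by e, while losing only the factor delta. *)
Lemma vanishing_multiplier (e : bool) c : exists z : nat -> V, [/\ ev z e%:R = 0,
  delta * sq (riesz_deriv c) <= int01 (pr h (der c) z) & sq z <= sq (riesz_deriv c)].
Proof.
(* x times the derivative of x^i is i x^i, so no index is shifted *)
pose y (i : nat) : V := i%:R *: rho (c i).
have yE x : ev y x = x *: ev (riesz_deriv c) x.
  rewrite /riesz_deriv peval_der scaler_sumr; apply: eq_bigr => -[[|i] hi] _.
    by rewrite /y/= !mul0r !scale0r !scaler0.
  by rewrite /y/= !scalerA exprS; congr (_ *: _); ring.
pose z := if e then riesz_deriv c - y else y.
pose w (x : R) := if e then 1 - x else x.
have zE x : ev z x = w x *: ev (riesz_deriv c) x.
  rewrite /z /w; case: e {z w} => //.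
  rewrite (_ : riesz_deriv c - y = (-1) *: y + riesz_deriv c); last by rewrite scaleN1r addrC.
  by rewrite peval_lin yE scaleN1r scalerBl scale1r addrC.
have w01 x : 0 <= x <= 1 -> [/\ 0 <= w x, w x <= 1 & x * (1 - x) <= w x].
  rewrite /w => /andP[x0 x1]; have x1' : 0 <= 1 - x by rewrite subr_ge0.
  have y0 : 0 <= x * (1 - x) by rewrite mulr_ge0.
  have y1 : 0 <= x * x by rewrite mulr_ge0.
  have y2 : 0 <= (1 - x) * (1 - x) by rewrite mulr_ge0.
  case: e {z w zE} => /=; split; lra.
exists z; split.
- by rewrite zE /w; case: e {z w zE w01}; rewrite ?subrr scale0r.
- apply: (@le_trans _ _ (int01 ('X * (1 - 'X) * pr g (riesz_deriv c) (riesz_deriv c)))).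
    rewrite /delta mulrC ler_pdivrMr ?mulr_gt0 ?ltr0n// mulrC mulrAC.
    by rewrite (le_trans (sq_le _))// mulrC ler_wpM2r.
  apply: le_int01 => x x01; rewrite hornerM !pform_horner// zE (bilZr hl).
  rewrite -rhoP gs -peval_riesz_deriv; have [w0 w1 w2] := w01 x x01.
  by rewrite !hornerE ler_wpM2r.
- apply: le_int01 => x x01; rewrite !pform_horner// zE (bilZr gl) (bilZl gl).
  have [w0 w1 w2] := w01 x x01; rewrite mulrA -[leRHS]mul1r ler_wpM2r//.
  by rewrite mulr_ile1.
Qed.

(** Small enough for the operator term of the corrector to be absorbed by half of
    the coercivity and half of the corrector's own gain. *)
Definition corr_weight := alpha * delta / M ^+ 2.
Lemma corr_weight_gt0 : 0 < corr_weight.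
Proof. by rewrite divr_gt0 ?mulr_gt0 ?delta_gt0// exprn_gt0. Qed.

(** What a corrector z for c on one element has to provide, for both orders of
    the arguments of a n so as to serve the problem and its adjoint. *)
Definition slab_corrector (e : bool) n (c z : nat -> V) : Prop :=
  let p := tau n * sq c in let r := (tau n)^-1 * sq (riesz_deriv c) in
  [/\ ev z e%:R = 0,
      corr_weight * delta * r <= int01 (pr h (der c) z),
      tau n * sq z <= corr_weight ^+ 2 * r,
      `|a n c z| <= alpha / 2 * p + corr_weight * delta / 2 * r
    & `|a n z c| <= alpha / 2 * p + corr_weight * delta / 2 * r].

Lemma slab_corrector_exists (e : bool) n c : (n < N)%N -> exists z, slab_corrector e n c z.
Proof.
move=> nN; have [z [z0 z1 z2]] := vanishing_multiplier e c.
have tp := tau_gt0 nN; have gp0 := corr_weight_gt0; have dp := delta_gt0.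
have prl := pform_bilin q gl; have prh := pform_bilin q hl; have al := a_bilin nN.
set k := corr_weight * (tau n)^-1.
have zr : tau n * sq ((tau n)^-1 *: z) <= (tau n)^-1 * sq (riesz_deriv c).
  rewrite [X in _ * X](bilZl prl) (bilZr prl) mulVKf ?gt_eqF//.
  by rewrite ler_wpM2l// invr_ge0 ltW.
exists (k *: z) => p r; split.
- by rewrite -[k *: z]addr0 peval_lin z0 scaler0 add0r /peval big1// => i _; rewrite scaler0.
- rewrite [leRHS](bilZr prh) /k -(mulrA corr_weight delta) -(mulrA corr_weight (tau n)^-1).
  apply: ler_wpM2l; first exact: ltW.
  by rewrite /r mulrCA; apply: ler_wpM2l => //; rewrite invr_ge0 ltW.
- rewrite -scalerA [X in _ * X](bilZl prl) (bilZr prl) mulrCA (mulrCA (tau n)) mulrA -expr2.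
  by rewrite ler_wpM2l// exprn_ge0// ltW.
- rewrite -scalerA (bilZr al) normrM (gtr0_norm gp0).
  have := a_bnd c ((tau n)^-1 *: z) nN (divr_gt0 M_gt0 dp).
  rewrite -/p => B.
  have B2 : 2 * `|a n c ((tau n)^-1 *: z)| <= M * (M / delta * p + (M / delta)^-1 * r).
    apply: (le_trans B); rewrite ler_wpM2l ?(ltW M_gt0)// lerD2l ler_wpM2l//.
    by rewrite invr_ge0 divr_ge0 ?ltW.
  rewrite -(ler_pM2l (x := 2))// mulrCA.
  apply: (le_trans (ler_wpM2l (ltW gp0) B2)).
  rewrite le_eqVlt; apply/orP; left; apply/eqP; rewrite /corr_weight.
  by field; rewrite !gt_eqF.
- rewrite -scalerA (bilZl al) normrM (gtr0_norm gp0).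
  have := a_bnd ((tau n)^-1 *: z) c nN (divr_gt0 dp M_gt0).
  rewrite -/p => B.
  have B2 : 2 * `|a n ((tau n)^-1 *: z) c| <= M * (delta / M * r + (delta / M)^-1 * p).
    apply: (le_trans B); rewrite ler_wpM2l ?(ltW M_gt0)// lerD2r ler_wpM2l//.
    by rewrite divr_ge0 ?ltW.
  rewrite -(ler_pM2l (x := 2))// mulrCA.
  apply: (le_trans (ler_wpM2l (ltW gp0) B2)).
  rewrite le_eqVlt; apply/orP; left; apply/eqP; rewrite /corr_weight.
  by field; rewrite !gt_eqF.
Qed.

(** Each element contributes half the difference of its end values, and
    h (u - v) u = (h u u + h (u - v) (u - v) - h v v) / 2 turns the jump terms
    into half jumps plus end values that telescope. *)
Lemma dg_form_energy C : dg_form C C =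
  \sum_(0 <= n < N) a n (C n) (C n) + 2^-1 * final C + 2^-1 * initial C + 2^-1 * jumps C.
Proof.
pose e n := 2^-1 * h (ev (C n) 1) (ev (C n) 1).
pose f n := 2^-1 * h (C n 0%N) (C n 0%N).
have T := telescope_sum e f N.-1.
rewrite /dg_form big_split/=.
rewrite (eq_bigr (fun n => e n - f n)); last first.
  by move=> n _; rewrite int01_pderiv_self// peval0 mulrBr. 
rewrite [X in _ + X](eq_bigr (fun n => f n - e n.-1 + 2^-1 *
  h (C n 0%N - ev (C n.-1) 1) (C n 0%N - ev (C n.-1) 1))); last first.
  move=> n _; rewrite /e /f !(bilBr hl, bilBl hl) (hs (ev _ _)).
  by lra.
rewrite [X in _ + X]big_split/= -mulr_sumr -/(jumps C) /final -/(e N.-1) -T.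
rewrite prednK// /initial /f; lra.
Qed.

Lemma dg_form_by_parts C D : dg_form C D =
  \sum_(0 <= n < N) (a n (C n) (D n) - int01 (pr h (C n) (der (D n))))
  + h (ev (C N.-1) 1) (ev (D N.-1) 1)
  + \sum_(1 <= n < N) h (ev (C n.-1) 1) (ev (D n.-1) 1 - D n 0%N).
Proof.
pose e n := h (ev (C n) 1) (ev (D n) 1).
pose f n := h (C n 0%N) (D n 0%N).
have T := telescope_sum e f N.-1; rewrite prednK// in T.
rewrite /dg_form (eq_bigr (fun n => a n (C n) (D n) - int01 (pr h (C n) (der (D n)))
  + (e n - f n))); last first.
  move=> n _; have := int01_by_parts q (C n) (D n) hl; rewrite !peval0 -/(e n) -/(f n).
  by lra.
rewrite [X in _ + X](eq_bigr (fun n => f n - e n.-1 +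
  h (ev (C n.-1) 1) (ev (D n.-1) 1 - D n 0%N))); last first.
  by move=> n _; rewrite /e /f (bilBr hl) (bilBl hl); lra.
rewrite big_split/= [X in _ + X]big_split/= -/(e N.-1) -T /f; lra.
Qed.

(** The three entries are the coefficients left for |w|_V, for the dual norm of
    w' and for the traces. *)
Definition stab_const : R := Num.min (alpha / 2) (Num.min (corr_weight * delta / 2) 2^-1).

(** The last factor bounds the mean square of a corrected function, the first adds
    its traces, and 1 its initial or final value. *)
Definition test_const : R := (1 + K ^+ 2 * q.+1%:R * C0) * (2 + 2 * corr_weight ^+ 2) + 1.

Lemma stab_const_gt0 : 0 < stab_const.
Proof.
by rewrite !lt_min invr_gt0 ltr0n/= andbT !divr_gt0 ?mulr_gt0 ?corr_weight_gt0 ?delta_gt0.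
Qed.

Let D0 : 0 <= K ^+ 2 * q.+1%:R * C0.
Proof. by apply: mulr_ge0; [apply: mulr_ge0 => //; exact: sqr_ge0|exact: ltW]. Qed.

Lemma test_const_gt0 : 0 < test_const.
Proof.
rewrite ltr_wpDl// mulr_ge0//; first by rewrite addr_ge0.
by rewrite addr_ge0// mulr_ge0// sqr_ge0.
Qed.

Definition X_sq C := int_X C + initial C + jumps C.
Definition Y_sq C := int_Y C + initial C + weighted C.
Definition Xt_sq C := int_X C + final C + jumps C.
Definition Yt_sq C := int_Y C + final C + weighted C.

Definition int_deriv C : R := \sum_(0 <= n < N) (tau n)^-1 * sq (riesz_deriv (C n)).

Lemma int_XE C : int_X C = int_deriv C + int_Y C.
Proof. by rewrite /int_X big_split. Qed.

Lemma int_deriv_ge0 C : 0 <= int_deriv C.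
Proof.
rewrite /int_deriv big_nat_cond sumr_ge0// => n /andP[/andP[_ nN] _].
by rewrite mulr_ge0 ?sq_ge0// invr_ge0 ltW// tau_gt0.
Qed.
Lemma int_Y_ge0 C : 0 <= int_Y C.
Proof.
rewrite /int_Y big_nat_cond sumr_ge0// => n /andP[/andP[_ nN] _].
by rewrite mulr_ge0 ?sq_ge0// ltW// tau_gt0.
Qed.
Lemma jumps_ge0 C : 0 <= jumps C. Proof. exact: sumr_ge0. Qed.
Lemma initial_ge0 C : 0 <= initial C. Proof. exact: hp. Qed.
Lemma final_ge0 C : 0 <= final C. Proof. exact: hp. Qed.
Lemma weighted_ge0 C : 0 <= weighted C.
Proof.
rewrite /weighted big_nat_cond sumr_ge0// => n /andP[/andP[_ nN] _].
by rewrite mulr_ge0// ltW// tau_gt0.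
Qed.

(** A trace at a node is bounded by the mean square on the adjacent element, at
    the price of 1 / tau, which the weight compensates. *)
Lemma weighted_le C : weighted C <= K ^+ 2 * q.+1%:R * C0 * int_Y C.
Proof.
apply: (@le_trans _ _ (\sum_(1 <= n < N) K ^+ 2 * q.+1%:R * C0 * (tau n * sq (C n)))).
  apply: ler_sum_nat => n /andP[_ nN]; rewrite mulrCA ler_wpM2l ?(ltW (tau_gt0 nN))//.
  by rewrite -(peval0 q) trace_le// lexx ler01.
rewrite -mulr_sumr; apply: ler_wpM2l => //.
by rewrite /int_Y [leRHS]big_ltn// lerDr mulr_ge0 ?sq_ge0// ltW// tau_gt0.
Qed.

Lemma slab_correctors (e : bool) (C : nat -> nat -> V) : exists Z : nat -> nat -> V,
  forall n, (n < N)%N -> slab_corrector e n (C n) (Z n).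
Proof.
suff /boolp.choice[Z HZ] : forall n, exists z, (n < N)%N -> slab_corrector e n (C n) z.
  by exists Z.
move=> n; have [nN|nN] := boolP (n < N)%N; last by exists 0.
by have [z Hz] := slab_corrector_exists e (C n) nN; exists z.
Qed.

Lemma int_Y_corrected (C Z : nat -> nat -> V) :
  (forall n, (n < N)%N -> tau n * sq (Z n) <= corr_weight ^+ 2 * ((tau n)^-1 * sq (riesz_deriv (C n)))) ->
  int_Y (C + Z) <= (2 + 2 * corr_weight ^+ 2) * int_X C.
Proof.
move=> HZ; rewrite /int_Y /int_X mulr_sumr; apply: ler_sum_nat => n /andP[_ nN].
have prl := pform_bilin q gl; have tp := tau_gt0 nN.
have prs : symf (fun c d : nat -> V => int01 (pr g c d)).
  by move=> c d; rewrite pform_sym.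
have := psd_sqD prl prs sq_ge0 (C n) (Z n) => H.
have {}H : tau n * sq (C n + Z n) <= 2 * (tau n * sq (C n)) + 2 * (tau n * sq (Z n)).
  by apply: (le_trans (ler_wpM2l (ltW tp) H)); rewrite le_eqVlt; apply/orP; left; apply/eqP; ring.
have r0 : 0 <= (tau n)^-1 * sq (riesz_deriv (C n)) by rewrite mulr_ge0 ?sq_ge0// invr_ge0 ltW.
have p0 : 0 <= tau n * sq (C n) by rewrite mulr_ge0 ?sq_ge0// ltW.
have g0 : 0 <= corr_weight ^+ 2 * (tau n * sq (C n)) by rewrite mulr_ge0// sqr_ge0.
by apply: (le_trans H); have := HZ n nN; lra.
Qed.

(** Test with C plus correctors vanishing at left ends, which enter neither the
    initial term nor the jumps of the test function. *)
Lemma stab_primal C : exists D, stab_const * X_sq C <= dg_form C D /\ Y_sq D <= test_const * X_sq C.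
Proof.
have [Z HZ] := slab_correctors false C; exists (C + Z); split.
  have -> : dg_form C (C + Z) = dg_form C C +
     \sum_(0 <= n < N) (int01 (pr h (der (C n)) (Z n)) + a n (C n) (Z n)).
    rewrite /dg_form.
    rewrite [X in X + _ + _ = _](_ : _ =
      \sum_(0 <= n < N) (int01 (pr h (der (C n)) (C n)) + a n (C n) (C n)) +
      \sum_(0 <= n < N) (int01 (pr h (der (C n)) (Z n)) + a n (C n) (Z n))); last first.
      rewrite -big_split/=; apply: eq_big_nat => n /andP[_ nN].
      rewrite [X in X + _](bilDr (pform_bilin q hl)) (bilDr (a_bilin nN)).
      by rewrite addrACA.
    have Z0 n : (n < N)%N -> (C + Z) n 0%N = C n 0%N.
      by move=> /HZ[+ _ _ _ _]; rewrite peval0 !fctE => ->; rewrite addr0.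
    rewrite Z0// [X in _ + _ + X = _](eq_big_nat _ _ (F2 := fun n =>
      h (C n 0%N - ev (C n.-1) 1) (C n 0%N))); last first.
      by move=> n /andP[_ nN]; rewrite Z0.
    lra.
  have : corr_weight * delta / 2 * int_deriv C - alpha / 2 * int_Y C <=
    \sum_(0 <= n < N) (int01 (pr h (der (C n)) (Z n)) + a n (C n) (Z n)).
    rewrite /int_deriv /int_Y !mulr_sumr -sumrB; apply: ler_sum_nat => n /andP[_ nN].
    have [_ h1 _ + _] := HZ n nN; rewrite ler_norml => /andP[h2 _].
    apply: (le_trans _ (lerD h1 h2)); lra.
  have : alpha * int_Y C <= \sum_(0 <= n < N) a n (C n) (C n).
    by rewrite /int_Y mulr_sumr; apply: ler_sum_nat => n /andP[_ nN]; exact: a_coer.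
  rewrite dg_form_energy /X_sq int_XE => h1 h2.
  have l1 : stab_const <= alpha / 2 by rewrite ge_min lexx.
  have l2 : stab_const <= corr_weight * delta / 2 by rewrite !ge_min lexx orbT.
  have l3 : stab_const <= 2^-1 by rewrite !ge_min lexx !orbT.
  have := ler_wpM2r (int_Y_ge0 C) l1; have := ler_wpM2r (int_deriv_ge0 C) l2.
  have := ler_wpM2r (initial_ge0 C) l3; have := ler_wpM2r (jumps_ge0 C) l3.
  have := final_ge0 C.
  rewrite !mulrDr; lra.
have H : int_Y (C + Z) <= (2 + 2 * corr_weight ^+ 2) * int_X C.
  by apply: int_Y_corrected => n /HZ[].
have I : initial (C + Z) = initial C.
  by rewrite /initial !fctE; have [+ _ _ _ _] := HZ 0%N N_gt0; rewrite peval0 => ->; rewrite addr0.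
have W := weighted_le (C + Z).
rewrite /Y_sq I /X_sq /test_const.
have X0 : 0 <= int_X C by rewrite int_XE addr_ge0 ?int_deriv_ge0 ?int_Y_ge0.
have := initial_ge0 C; have := jumps_ge0 C => j0 i0.
set k := K ^+ 2 * q.+1%:R * C0 in W *; set m := 2 + 2 * corr_weight ^+ 2 in H *.
have k0 : 0 <= k by exact: D0.
have m0 : 0 <= m by rewrite /m addr_ge0// mulr_ge0// sqr_ge0.
have := ler_wpM2l k0 H => kH.
have : 0 <= ((1 + k) * m) * (initial C + jumps C) by rewrite mulr_ge0 ?addr_ge0// mulr_ge0// addr_ge0.
clearbody k m; move=> P; lra.
Qed.

(** In the form integrated by parts, the first argument enters the node terms
    only through its right end values, so correctors vanishing there are
    subtracted. *)
Lemma stab_adjoint D : exists C, stab_const * Xt_sq D <= dg_form C D /\ Yt_sq C <= test_const * Xt_sq D.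
Proof.
have [Z HZ] := slab_correctors true D; exists (D - Z).
have DZ n c : (n < N)%N -> a n (D n - Z n) c = a n (D n) c - a n (Z n) c.
  by move=> nN; rewrite (bilBl (a_bilin nN)).
have Z1 n : (n < N)%N -> ev (D n - Z n) 1 = ev (D n) 1.
  move=> /HZ[z1 _ _ _ _].
  rewrite (_ : D n - Z n = (-1) *: Z n + D n); last by rewrite scaleN1r addrC.
  by rewrite peval_lin z1 scaler0 add0r.
split.
  have -> : dg_form (D - Z) D = dg_form D D +
     \sum_(0 <= n < N) (int01 (pr h (der (D n)) (Z n)) - a n (Z n) (D n)).
    rewrite !dg_form_by_parts.
    rewrite [X in X + _ + _ = _](_ : _ =
      \sum_(0 <= n < N) (a n (D n) (D n) - int01 (pr h (D n) (der (D n)))) +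
      \sum_(0 <= n < N) (int01 (pr h (der (D n)) (Z n)) - a n (Z n) (D n))); last first.
      rewrite -big_split/=; apply: eq_big_nat => n /andP[_ nN].
      rewrite !fctE DZ// [X in _ - X = _](bilBl (pform_bilin q hl)) (pform_sym q (Z n))//; lra.
    rewrite !fctE Z1 ?prednK// [X in _ + _ + X = _](eq_big_nat _ _ (F2 := fun n =>
      h (ev (D n.-1) 1) (ev (D n.-1) 1 - D n 0%N))); last first.
      by case=> // n /andP[_ nN]; rewrite Z1//= ltnW.
    lra.
  have : corr_weight * delta / 2 * int_deriv D - alpha / 2 * int_Y D <=
    \sum_(0 <= n < N) (int01 (pr h (der (D n)) (Z n)) - a n (Z n) (D n)).
    rewrite /int_deriv /int_Y !mulr_sumr -sumrB; apply: ler_sum_nat => n /andP[_ nN].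
    have [_ h1 _ _] := HZ n nN; rewrite ler_norml => /andP[_ h2].
    apply: (le_trans _ (lerB h1 h2)); lra.
  have : alpha * int_Y D <= \sum_(0 <= n < N) a n (D n) (D n).
    by rewrite /int_Y mulr_sumr; apply: ler_sum_nat => n /andP[_ nN]; exact: a_coer.
  rewrite dg_form_energy /Xt_sq int_XE => h1 h2.
  have l1 : stab_const <= alpha / 2 by rewrite ge_min lexx.
  have l2 : stab_const <= corr_weight * delta / 2 by rewrite !ge_min lexx orbT.
  have l3 : stab_const <= 2^-1 by rewrite !ge_min lexx !orbT.
  have := ler_wpM2r (int_Y_ge0 D) l1; have := ler_wpM2r (int_deriv_ge0 D) l2.
  have := ler_wpM2r (final_ge0 D) l3; have := ler_wpM2r (jumps_ge0 D) l3.
  have := initial_ge0 D.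
  rewrite !mulrDr; lra.
have H : int_Y (D - Z) <= (2 + 2 * corr_weight ^+ 2) * int_X D.
  apply: int_Y_corrected => n /HZ[_ _ + _ _].
  by rewrite -scaleN1r [X in _ -> _ * X <= _](bilZl (pform_bilin q gl)) (bilZr (pform_bilin q gl)) !mulN1r opprK.
have I : final (D - Z) = final D.
  by rewrite /final !fctE Z1 ?prednK.
have W := weighted_le (D - Z).
rewrite /Yt_sq I /Xt_sq /test_const.
have X0 : 0 <= int_X D by rewrite int_XE addr_ge0 ?int_deriv_ge0 ?int_Y_ge0.
have := final_ge0 D; have := jumps_ge0 D => j0 i0.
set k := K ^+ 2 * q.+1%:R * C0 in W *; set m := 2 + 2 * corr_weight ^+ 2 in H *.
have k0 : 0 <= k by exact: D0.
have m0 : 0 <= m by rewrite /m addr_ge0// mulr_ge0// sqr_ge0.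
have := ler_wpM2l k0 H => kH.
have : 0 <= ((1 + k) * m) * (final D + jumps D) by rewrite mulr_ge0 ?addr_ge0// mulr_ge0// addr_ge0.
clearbody k m; move=> P; lra.
Qed.

Notation ss := (array_dot g q N).
Notation bounded_form := (bdd_form g q N).
Notation bounded_lin := (bdd_lin g q N).

Lemma g_CS u v : g u v ^+ 2 <= 1 * (g u u * g v v).
Proof. by rewrite mul1r psd_CS. Qed.

Lemma h_CS u v : h u v ^+ 2 <= K ^+ 2 * K ^+ 2 * (g u u * g v v).
Proof.
by apply: (le_trans (psd_CS hl hs hp u v)); rewrite mulrACA ler_pM.
Qed.

Let K4 : 0 <= K ^+ 2 * K ^+ 2.
Proof. by apply: mulr_ge0; exact: sqr_ge0. Qed.

Lemma bdd_form_int01 (k : V -> V -> R) kap (F G : (nat -> nat -> V) -> nat -> V) :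
  bilin k -> 0 <= kap -> (forall u v, k u v ^+ 2 <= kap * (g u u * g v v)) ->
  (forall i, (i < q.+1)%N -> bounded_lin (fun C => F C i)) ->
  (forall i, (i < q.+1)%N -> bounded_lin (fun C => G C i)) ->
  bounded_form (fun C D => int01 (pr k (F C) (G D))).
Proof.
move=> kl kap0 kP FP GP.
rewrite (_ : (fun C D => _) = fun C D => \sum_(i < q.+1) \sum_(j < q.+1)
   int01 'X^(i + j) * k (F C i) (G D j)).
  apply: bdd_form_sum => i _; apply: bdd_form_sum => j _; apply: bdd_formZ.
  exact: bdd_form_lin kl kap0 kP (FP i (ltn_ord i)) (GP j (ltn_ord j)).
apply/funext => C; apply/funext => D; rewrite /pform int01_sum; apply: eq_bigr => i _.
by rewrite int01_sum; apply: eq_bigr => j _; rewrite int01Z mulrC.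
Qed.

Lemma coef_sq_le_array C n : (n < N)%N -> coef_sq q g (C n) <= ss C C.
Proof.
move=> nN; rewrite /array_dot big_mkord (bigD1 (Ordinal nN))//= lerDl.
by apply: sumr_ge0 => m _; apply: sumr_ge0.
Qed.

Lemma bdd_form_a n : (n < N)%N -> bounded_form (fun C D => a n (C n) (D n)).
Proof.
move=> nN; have al := a_bilin nN; have tp := tau_gt0 nN.
split; first by split=> C k D E; rewrite !fctE ?(al.1 (C n)) ?(al.2 (C n)).
set k := M * (tau n * q.+1%:R).
have k0 : 0 <= k by rewrite /k mulr_ge0 ?(ltW M_gt0)// mulr_ge0// ltW.
have kP C : M * (tau n * sq (C n)) <= k * ss C C.
  rewrite /k -!mulrA ler_wpM2l ?(ltW M_gt0)// ler_wpM2l ?(ltW tp)//.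
  by apply: (le_trans (sq_le _)); rewrite ler_wpM2l// coef_sq_le_array.
have s0 C : 0 <= M * (tau n * sq (C n)).
  by rewrite mulr_ge0 ?(ltW M_gt0)// mulr_ge0 ?sq_ge0// ltW.
exists (k * k) => [|C D]; first exact: mulr_ge0.
rewrite mulrACA; apply: (@le_trans _ _ (M * (tau n * sq (C n)) * (M * (tau n * sq (D n))))).
  apply: young_sq => // th th0; rewrite !(mulrCA _ M) -mulrDr; exact: a_bnd.
by apply: ler_pM.
Qed.

Lemma dg_form_bdd : bounded_form dg_form.
Proof.
apply: bdd_formD; first apply: bdd_formD.
- apply: bdd_form_sum => n; rewrite mem_index_iota => /= nN; apply: bdd_formD.
    apply: (bdd_form_int01 hl K4 h_CS) => i iq; first exact: bdd_lin_pderiv.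
    exact: bdd_lin_coord.
  exact: bdd_form_a.
- exact: (bdd_form_lin gp hl K4 h_CS (bdd_lin_coord gp N_gt0 (ltn0Sn q))
    (bdd_lin_coord gp N_gt0 (ltn0Sn q))).
- apply: bdd_form_sum => n; rewrite mem_index_iota => /andP[n1 nN].
  have nN' : (n.-1 < N)%N by rewrite (leq_ltn_trans (leq_pred n)).
  have L : bounded_lin (fun C => C n 0%N + (-1) *: ev (C n.-1) 1).
    apply: bdd_linD => //; first exact: bdd_lin_coord.
    exact: (bdd_linZ gl _ (bdd_lin_peval q gl gs gp 1 nN')).
  have := bdd_form_lin gp hl K4 h_CS L (bdd_lin_coord gp nN (ltn0Sn q)).
  by under eq_fun => C do under eq_fun => D do rewrite scaleN1r.
Qed.

Definition Yt_dot (C D : nat -> nat -> V) : R :=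
  \sum_(0 <= n < N) tau n * int01 (pr g (C n) (D n)) +
  h (ev (C N.-1) 1) (ev (D N.-1) 1) +
  \sum_(1 <= n < N) tau n * h (C n 0%N) (D n 0%N).

Lemma int_Y_le_norms C :
  [/\ int_Y C <= X_sq C, int_Y C <= Y_sq C, int_Y C <= Xt_sq C & int_Y C <= Yt_sq C].
Proof.
rewrite /X_sq /Y_sq /Xt_sq /Yt_sq int_XE; have := int_deriv_ge0 C; have := initial_ge0 C.
by have := final_ge0 C; have := jumps_ge0 C; have := weighted_ge0 C; split; lra.
Qed.

Lemma Yt_dotE C : Yt_dot C C = Yt_sq C. Proof. by []. Qed.

Lemma Yt_dot_bdd : bounded_form Yt_dot.
Proof.
apply: bdd_formD; first apply: bdd_formD.
- apply: bdd_form_sum => n; rewrite mem_index_iota => /= nN; apply: bdd_formZ.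
  by apply: (bdd_form_int01 gl ler01 g_CS) => i iq; exact: bdd_lin_coord.
- have N1 : (N.-1 < N)%N by rewrite prednK.
  have L := bdd_lin_peval q gl gs gp 1 N1.
  exact: (bdd_form_lin gp hl K4 h_CS L L).
- apply: bdd_form_sum => n; rewrite mem_index_iota => /andP[n1 nN].
  have L := bdd_lin_coord gp nN (ltn0Sn q).
  exact: (bdd_formZ _ (bdd_form_lin gp hl K4 h_CS L L)).
Qed.

Lemma Yt_sq_ge0 C : 0 <= Yt_sq C.
Proof. by rewrite !addr_ge0 ?int_Y_ge0 ?final_ge0 ?weighted_ge0. Qed.

Lemma Yt_dot_sym : symf Yt_dot.
Proof.
move=> C D; rewrite /Yt_dot (hs (ev _ _)); congr (_ + _ + _); apply: eq_bigr => n _.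
  by rewrite pform_sym.
by rewrite hs.
Qed.

(** Equivalence of the array norm with the integral of |v|_V^2.  The constant
    involves the inverse lengths of the elements.  It enters the solvability of
    the adjoint problem, the tolerance on its residual and the finiteness of the
    suprema, none of which is seen by the inf-sup constants. *)
Lemma array_dot_le_int_Y : exists2 k, 0 < k & forall C, ss C C <= k * int_Y C.
Proof.
pose T := \sum_(0 <= n < N) (tau n)^-1.
have TP n : (n < N)%N -> (tau n)^-1 <= T.
  move=> nN; rewrite /T big_mkord (bigD1 (Ordinal nN))//= lerDl.
  by apply: sumr_ge0 => m _; rewrite invr_ge0 ltW// tau_gt0.
have T0 : 0 < T by apply: lt_le_trans (TP 0%N N_gt0); rewrite invr_gt0 tau_gt0.
exists (C0 * T) => [|C]; first exact: mulr_gt0.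
rewrite /array_dot /int_Y mulr_sumr; apply: ler_sum_nat => n /andP[_ nN].
apply: (le_trans (coef_sq_le (C n))); rewrite -mulrA ler_wpM2l ?(ltW C0_gt0)// mulrA.
apply: ler_peMl; first exact: sq_ge0.
have := ler_wpM2r (ltW (tau_gt0 nN)) (TP n nN).
by rewrite mulVf// gt_eqF// tau_gt0.
Qed.

Lemma dg_form_coercive C : alpha * int_Y C <= dg_form C C.
Proof.
have : alpha * int_Y C <= \sum_(0 <= n < N) a n (C n) (C n).
  by rewrite /int_Y mulr_sumr; apply: ler_sum_nat => n /andP[_ nN]; exact: a_coer.
rewrite dg_form_energy; have := final_ge0 C; have := initial_ge0 C; have := jumps_ge0 C; lra.
Qed.

Lemma dg_form_le_int_Y : exists B, forall C D, dg_form C D ^+ 2 <= B * (int_Y C * int_Y D).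
Proof.
have [_ [B B0 BP]] := dg_form_bdd; have [k k0 kP] := array_dot_le_int_Y.
exists (B * (k * k)) => C D; apply: (le_trans (BP C D)).
rewrite -mulrA; apply: ler_wpM2l => //; rewrite mulrACA.
by apply: ler_pM => //; apply: array_dot_ge0.
Qed.

Hypothesis riesz : forall f : V -> R, scalar f ->
  (exists B, forall u, f u ^+ 2 <= B * g u u) -> exists r, forall u, f u = g r u.

Lemma Xt_sq_ge0 C : 0 <= Xt_sq C.
Proof. by rewrite !addr_ge0 ?int_XE ?addr_ge0 ?int_deriv_ge0 ?int_Y_ge0 ?final_ge0 ?jumps_ge0. Qed.

(** D solves dg_form F D = Yt_dot W F for all F up to a residual e.  Taking F = W
    gives the first inequality.  Taking for F the function that [stab_adjoint]
    provides for D bounds stab_const |D|_X^2 by a multiple of |W|_Y |F|_Y, hence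
    of |W|_Y |D|_X, which is the second one. *)
Lemma adjoint_problem W : 0 < Yt_sq W -> exists D,
  2^-1 * Yt_sq W <= dg_form W D /\ stab_const ^+ 2 * Xt_sq D <= 4 * test_const * Yt_sq W.
Proof.
move=> W0; have [k k0 kP] := array_dot_le_int_Y; have [bl [B B0 BP]] := dg_form_bdd.
have [yl [Y Y0 YP]] := Yt_dot_bdd.
have kY C : ss C C <= k * Yt_sq C.
  apply: (le_trans (kP C)); rewrite ler_wpM2l ?(ltW k0)//.
  by case: (int_Y_le_norms C).
have coer C : alpha / k * ss C C <= dg_form C C.
  apply: le_trans (dg_form_coercive C); rewrite -mulrA ler_wpM2l ?(ltW alpha_gt0)//.
  by rewrite mulrC ler_pdivrMr// mulrC.
have fB : exists L, forall C, Yt_dot W C ^+ 2 <= L * ss C C.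
  by exists (Y * ss W W) => C; rewrite -mulrA.
have ek0 : 0 < Yt_sq W / (4 * k) by rewrite divr_gt0// mulr_gt0.
have ssl := array_dot_bilin q N gl; have sss := array_dot_sym q N gs; have ssp := array_dot_ge0 q N gp.
have [D [e [eP eB]]] := lax_milgram_approx ssl sss ssp bl BP
  (divr_gt0 alpha_gt0 k0) coer (riesz_arrays gl riesz) (yl.1 W) fB ek0.
(* the tolerance makes the residual at most half of |W| |C| *)
have se C : ss e C ^+ 2 <= 4^-1 * (Yt_sq W * Yt_sq C).
  apply: (le_trans (psd_CS ssl sss ssp e C)).
  apply: (le_trans (ler_pM (ssp _) (ssp _) eB (kY C))).
  rewrite le_eqVlt; apply/orP; left; apply/eqP; field; rewrite gt_eqF//.
exists D; split.
  have := eP W; rewrite Yt_dotE => E.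
  have : ss e W <= 2^-1 * Yt_sq W.
    rewrite (le_trans (ler_norm _))// -ler_sqr ?nnegrE ?normr_ge0//; last lra.
    by rewrite real_normK ?num_real//; have := se W; lra.
  lra.
have [F [F1 F2]] := stab_adjoint D.
have X0 := Xt_sq_ge0 D.
(* the estimate is quadratic in D: divide by |D|^2 unless it vanishes *)
have [->|XN] := eqVneq (Xt_sq D) 0.
  by rewrite mulr0 mulr_ge0 ?mulr_ge0 ?(ltW test_const_gt0)// ltW.
have Xp : 0 < Xt_sq D by rewrite lt_neqAle eq_sym XN.
have yB : Yt_dot W F ^+ 2 <= Yt_sq W * Yt_sq F by exact: (psd_CS yl Yt_dot_sym Yt_sq_ge0).
have E := eP F; have sF := se F.
have WF : Yt_sq W * Yt_sq F <= Yt_sq W * (test_const * Xt_sq D) by rewrite ler_wpM2l// ltW.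
have c00 : 0 <= stab_const * Xt_sq D by rewrite mulr_ge0// ltW// stab_const_gt0.
have : (stab_const * Xt_sq D) ^+ 2 <= dg_form F D ^+ 2 by rewrite ler_sqr ?nnegrE// (le_trans c00).
have := sqr_ge0 (Yt_dot W F + ss e F).
have -> : dg_form F D = Yt_dot W F - ss e F by lra.
move=> h1 h2.
rewrite -(ler_pM2r Xp); have : 0 <= Yt_sq W * (test_const * Xt_sq D).
  by rewrite mulr_ge0 ?(ltW W0)// mulr_ge0// ltW// test_const_gt0.
lra.
Qed.

Definition infsup_const : R := stab_const / Num.sqrt test_const.
Definition adjoint_infsup_const : R := stab_const / (4 * Num.sqrt test_const).

Lemma infsup_const_gt0 : 0 < infsup_const.
Proof. by rewrite divr_gt0 ?stab_const_gt0// sqrtr_gt0 test_const_gt0. Qed.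
Lemma adjoint_infsup_const_gt0 : 0 < adjoint_infsup_const.
Proof. by rewrite divr_gt0 ?stab_const_gt0// mulr_gt0// sqrtr_gt0 test_const_gt0. Qed.

Let sC1 : 0 < Num.sqrt test_const. Proof. by rewrite sqrtr_gt0 test_const_gt0. Qed.

Lemma infsup_primal C : 0 < int_Y C -> exists D, 0 < dg_form C D /\
  infsup_const * (Num.sqrt (X_sq C) * Num.sqrt (Y_sq D)) <= dg_form C D.
Proof.
move=> C_gt0; have [D [h1 h2]] := stab_primal C; exists D.
have X0 : 0 < X_sq C.
  by apply: lt_le_trans C_gt0 _; case: (int_Y_le_norms C).
split; first by apply: lt_le_trans h1; rewrite mulr_gt0 ?stab_const_gt0.
apply: le_trans h1.
have {h2} : Num.sqrt (Y_sq D) <= Num.sqrt test_const * Num.sqrt (X_sq C).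
  by rewrite -sqrtrM ?(ltW test_const_gt0)// ler_wsqrtr.
move/(ler_wpM2l (sqrtr_ge0 (X_sq C)))/(ler_wpM2l (ltW infsup_const_gt0)) => XY.
apply: (le_trans XY); rewrite [_ * (Num.sqrt test_const * _)]mulrCA -expr2 sqr_sqrtr ?(ltW X0)// mulrA.
by rewrite /infsup_const divfK// gt_eqF.
Qed.

Lemma infsup_adjoint W : 0 < int_Y W -> exists D, 0 < dg_form W D /\
  adjoint_infsup_const * (Num.sqrt (Yt_sq W) * Num.sqrt (Xt_sq D)) <= dg_form W D.
Proof.
move=> W_gt0; have Y0 : 0 < Yt_sq W.
  by apply: lt_le_trans W_gt0 _; case: (int_Y_le_norms W).
have [D [h1 h2]] := adjoint_problem Y0; exists D.
split; first by apply: lt_le_trans h1; rewrite mulr_gt0// invr_gt0.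
apply: le_trans h1; have cp := stab_const_gt0; have dp := test_const_gt0.
have {h2} : stab_const * Num.sqrt (Xt_sq D) <= 2 * Num.sqrt test_const * Num.sqrt (Yt_sq W).
  rewrite -ler_sqr ?nnegrE ?mulr_ge0 ?sqrtr_ge0 ?(ltW cp)//.
  rewrite !exprMn !sqr_sqrtr ?Xt_sq_ge0 ?(ltW Y0) ?(ltW dp)//.
  by have -> : 2 ^+ 2 = 4 :> R by ring.
move=> XY; rewrite -{2}(sqr_sqrtr (ltW Y0)) expr2 mulrCA (mulrCA 2^-1).
apply: ler_wpM2l; first exact: sqrtr_ge0.
rewrite /adjoint_infsup_const mulrAC ler_pdivrMr ?mulr_gt0//; apply: (le_trans XY).
rewrite le_eqVlt; apply/orP; left; apply/eqP; by field.
Qed.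

(** The constant depends on W and the partition; it serves only to show that the
    suprema are finite and that norms do not vanish. *)
Lemma dg_form_right_bounded W : exists2 L, 0 <= L & forall D,
  dg_form W D <= L * Num.sqrt (Y_sq D) /\ dg_form W D <= L * Num.sqrt (Xt_sq D).
Proof.
have [B BP] := dg_form_le_int_Y; pose L := Num.sqrt (`|B| * int_Y W).
have H D z : int_Y D <= z -> dg_form W D <= L * Num.sqrt z.
  move=> Dz; apply: (le_trans (ler_norm _)); rewrite -sqrtr_sqr.
  rewrite -sqrtrM ?mulr_ge0 ?int_Y_ge0//; apply: ler_wsqrtr.
  apply: (le_trans (BP W D)); rewrite -mulrA.
  apply: (@le_trans _ _ (`|B| * (int_Y W * int_Y D))).
    by apply: ler_wpM2r; [rewrite mulr_ge0 ?int_Y_ge0|exact: ler_norm].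
  by apply: ler_wpM2l => //; apply: ler_wpM2l => //; exact: int_Y_ge0.
exists L => [|D]; first exact: sqrtr_ge0.
by split; apply: H; case: (int_Y_le_norms D).
Qed.

Lemma int_Y_eq0 C : (forall u, g u u = 0 -> u = 0) -> int_Y C = 0 ->
  forall n x, (n < N)%N -> ev (C n) x = 0.
Proof.
move=> g0 C_eq0 n x nN; have [k k0 kP] := array_dot_le_int_Y.
have : coef_sq q g (C n) = 0.
  apply/eqP; rewrite eq_le coef_sq_ge0// andbT (le_trans (coef_sq_le_array C nN))//.
  by rewrite (le_trans (kP C))// C_eq0 mulr0.
move/eqP; rewrite psumr_eq0// => /allP cn0.
rewrite /peval big1// => i _; have /implyP := cn0 i (mem_index_enum _).
by move=> /(_ isT) /eqP /g0 ->; rewrite scaler0.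
Qed.

End Discrete.

(** * Integrals of functions that need not be measurable *)

(** The integrand s |-> A s (w s) (v s) is only almost everywhere equal to a Borel
    function, while the integral is taken with respect to Lebesgue measure on the
    Borel sets.  The integral is defined for arbitrary functions through simple
    functions below them, and this definition is insensitive to null sets. *)
Section AeIntegral.
Context d (T : measurableType d) (R : realType) (mu : {measure set T -> \bar R}).
Local Open Scope ereal_scope.
Import HBNNSimple.

(** A simple function below f, cut off on Z, has the same integral and lies below
    the cut-off of f. *)
Lemma ge0_integral_restrictC (f : T -> \bar R) (Z : set T) :
  (forall x, 0 <= f x) -> measurable Z -> mu Z = 0 ->
  \int[mu]_x f x = \int[mu]_x (f \_ (~` Z)) x.
Proof.
move=> f0 mZ Z0; have mZC : measurable (~` Z) by exact: measurableC.
have fZ0 x : 0 <= (f \_ (~` Z)) x by rewrite /patch; case: ifP.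
rewrite !ge0_integralTE//; apply/eqP; rewrite eq_le; apply/andP; split.
  apply/ge_ereal_sup => _ [h /= hf <-].
  have -> : sintegral mu h = sintegral mu (proj_nnsfun h mZC).
    have E (k : {nnsfun T >-> R}) : sintegral mu k = \int[mu]_x (k x)%:E.
      by rewrite integral_nnsfun// patch_setT.
    rewrite !E.
    apply: ae_eq_integral => //; [exact/measurable_EFinP|exact/measurable_EFinP|].
    exists Z; split => // x /= /not_implyP[_ hx].
    apply: contrapT => nZ; apply: hx.
    by rewrite /proj_nnsfun/= mindicE mem_set ?mulr1.
  apply: ereal_sup_ubound; exists (proj_nnsfun h mZC) => //= x.
  rewrite mindicE /patch; case: ifPn => xZ; first by rewrite mulr1.
  by rewrite mulr0.
apply/ge_ereal_sup => _ [h /= hf <-].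
apply: ereal_sup_ubound; exists h => //= x.
apply: (le_trans (hf x)); rewrite /patch; case: ifP => // _; exact: f0.
Qed.

Lemma ge0_integral_ae (D : set T) (f g : T -> \bar R) :
  (forall x, 0 <= f x) -> (forall x, 0 <= g x) ->
  {ae mu, forall x, D x -> f x = g x} ->
  \int[mu]_(x in D) f x = \int[mu]_(x in D) g x.
Proof.
move=> f0 g0 [Z [mZ Z0 DZ]].
have p0 (k : T -> \bar R) : (forall x, 0 <= k x) -> forall x, 0 <= (k \_ D) x.
  by move=> k0 x; rewrite /patch; case: ifP.
rewrite integral_mkcond [RHS]integral_mkcond.
rewrite (ge0_integral_restrictC (p0 _ f0) mZ Z0) (ge0_integral_restrictC (p0 _ g0) mZ Z0).
congr (integral _ _ _); apply/funext => x; rewrite /patch.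
case: ifPn => // /set_mem xZ; case: ifPn => // /set_mem Dx.
by apply: contrapT => fg; apply: xZ; apply: DZ => /= /(_ Dx).
Qed.

Lemma integral_ae (D : set T) (f g : T -> \bar R) :
  {ae mu, forall x, D x -> f x = g x} ->
  \int[mu]_(x in D) f x = \int[mu]_(x in D) g x.
Proof.
move=> fg; rewrite integralE [RHS]integralE.
congr (_ - _); apply: ge0_integral_ae => //;
  by apply: filterS fg => x + Dx => /(_ Dx) e; rewrite ?funeposE ?funenegE e.
Qed.

End AeIntegral.

#[local] Instance lebesgue_ae_filter (R : realType) :
  Filter (almost_everywhere (@lebesgue_measure R)).
Proof. exact: (ae_filter_ringOfSetsType (@lebesgue_measure R)). Qed.

(** ** Bounded functions equal to Borel functions almost everywhere *)

(** This class contains the coefficients A s u v and the polynomials and is closed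
    under products, so it contains all integrands of the problem; on it the
    integral is linear. *)
Section AeBounded.
Context {R : realType}.
Variables (a b : R).
Notation mu := (@lebesgue_measure R).
Let D : set R := `]a, b].
Implicit Types f g : R -> R.

Definition ae_bounded f : Prop := exists2 G : R -> R,
  measurable_fun D G /\ (exists B, forall s, D s -> `|G s| <= B) &
  {ae mu, forall s, D s -> f s = G s}.

Lemma Rintegral_ae f g : {ae mu, forall s, D s -> f s = g s} ->
  \int[mu]_(s in D) f s = \int[mu]_(s in D) g s.
Proof.
move=> fg; rewrite /Rintegral; congr fine; apply: integral_ae.
by apply: filterS fg => s + Ds => /(_ Ds) ->.
Qed.

Lemma ae_bounded_ae f g : {ae mu, forall s, D s -> f s = g s} ->
  ae_bounded g -> ae_bounded f.
Proof.
move=> fg [G GP gG]; exists G => //.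
by apply: (filterS2 _ _ fg gG) => s + + Ds => /(_ Ds) -> /(_ Ds).
Qed.

Lemma ae_boundedD f g : ae_bounded f -> ae_bounded g ->
  ae_bounded (fun s => f s + g s).
Proof.
move=> [F [mF [B FB]] fF] [G [mG [B' GB]] gG]; exists (fun s => F s + G s).
  split; first exact: measurable_funD.
  exists (B + B') => s Ds; apply: (le_trans (ler_normD _ _)).
  by rewrite lerD ?FB ?GB.
by apply: (filterS2 _ _ fF gG) => s + + Ds => /(_ Ds) -> /(_ Ds) ->.
Qed.

Lemma ae_boundedM f g : ae_bounded f -> ae_bounded g ->
  ae_bounded (fun s => f s * g s).
Proof.
move=> [F [mF [B FB]] fF] [G [mG [B' GB]] gG]; exists (fun s => F s * G s).
  split; first exact: measurable_funM.
  by exists (B * B') => s Ds; rewrite normrM ler_pM ?FB ?GB.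
by apply: (filterS2 _ _ fF gG) => s + + Ds => /(_ Ds) -> /(_ Ds) ->.
Qed.

Lemma ae_bounded_poly (p : {poly R}) : ae_bounded (horner p).
Proof.
exists (horner p); last by apply: aeW.
split; first exact: measurable_poly.
have [B BP] := poly_itv_bound p a b; exists B => s.
by rewrite /D/= in_itv/= => /andP[/ltW ? ?]; apply: BP; apply/andP.
Qed.

Lemma ae_bounded_cst k : ae_bounded (fun=> k).
Proof.
by have := ae_bounded_poly k%:P; under [horner _]funext do rewrite hornerC.
Qed.

Lemma ae_bounded_sum (I : Type) (r : seq I) (F : I -> R -> R) :
  (forall i, ae_bounded (F i)) -> ae_bounded (fun s => \sum_(i <- r) F i s).
Proof.
move=> HF; elim: r => [|i r IH].
  rewrite (_ : (fun s => _) = fun=> 0); first exact: ae_bounded_cst.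
  by apply/funext => s; rewrite big_nil.
rewrite (_ : (fun s => _) = fun s => F i s + \sum_(j <- r) F j s).
  exact: ae_boundedD.
by apply/funext => s; rewrite big_cons.
Qed.

Let mD : measurable D. Proof. exact: measurable_itv. Qed.

Let bounded_integrable (G : R -> R) : measurable_fun D G ->
  (exists B, forall s, D s -> `|G s| <= B) -> mu.-integrable D (EFin \o G).
Proof.
move=> mG [B GB]; apply: measurable_bounded_integrable => //.
  have E := lebesgue_measure_itv (`]a, b] : interval R).
  rewrite [X in (X < _)%E]E; case: ifP => _; last exact: ltry.
  by rewrite -EFinB ltry.
exists B; split; first exact: num_real.
by move=> M BM s Ds /=; rewrite (le_trans (GB s Ds))// ltW.
Qed.

Lemma ae_bounded_linear k f g : ae_bounded f -> ae_bounded g ->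
  \int[mu]_(s in D) (k * f s + g s) =
  k * \int[mu]_(s in D) f s + \int[mu]_(s in D) g s.
Proof.
move=> [F [mF FB] fF] [G [mG GB] gG].
rewrite (Rintegral_ae fF) (Rintegral_ae gG).
rewrite (@Rintegral_ae _ (fun s => k * F s + G s)); last first.
  by apply: (filterS2 _ _ fF gG) => s + + Ds => /(_ Ds) -> /(_ Ds) ->.
have iF := bounded_integrable mF FB; have iG := bounded_integrable mG GB.
rewrite RintegralD//; last first.
  by apply: bounded_integrable; [exact: measurable_funM|];
    have [B BP] := FB; exists (`|k| * B) => s Ds; rewrite normrM ler_wpM2l ?BP.
by rewrite RintegralZl.
Qed.

(** Replacing f by its absolute value changes it on a null set only, which the
    integral does not see even if f is not measurable. *)
Lemma ae_ge0_Rintegral f : {ae mu, forall s, D s -> 0 <= f s} ->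
  0 <= \int[mu]_(s in D) f s.
Proof.
move=> f0; rewrite (@Rintegral_ae _ (fun s => `|f s|)); first exact: Rintegral_ge0.
by apply: filterS f0 => s + Ds => /(_ Ds) ?; rewrite ger0_norm.
Qed.

Lemma ae_le_Rintegral f g : ae_bounded f -> ae_bounded g ->
  {ae mu, forall s, D s -> f s <= g s} ->
  \int[mu]_(s in D) f s <= \int[mu]_(s in D) g s.
Proof.
move=> bf bg fg; have := ae_bounded_linear (-1) bf bg.
rewrite mulN1r addrC => e; rewrite -subr_ge0 -e; apply: ae_ge0_Rintegral.
by apply: filterS fg => s + Ds => /(_ Ds) ?; rewrite mulN1r addrC subr_ge0.
Qed.

Hypothesis ab : a < b.

Lemma Rintegral_deriv_poly (P : {poly R}) :
  \int[mu]_(s in D) (P^`()).[s] = P.[b] - P.[a].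
Proof.
have [G [mG GB] _] := ae_bounded_poly P^`().
rewrite /D Rintegral_itv_obnd_cbnd; last first.
  apply: bounded_integrable; first exact: measurable_poly.
  have [B BP] := poly_itv_bound P^`() a b; exists B => s.
  by rewrite /D/= in_itv/= => /andP[/ltW ? ?]; apply: BP; apply/andP.
rewrite /Rintegral (@continuous_FTC2 _ _ (horner P))//.
- exact/continuous_subspaceT/continuous_horner.
- split; first by move=> x _; exact: derivable_horner.
    by apply: cvg_at_right_filter; exact: continuous_horner.
  by apply: cvg_at_left_filter; exact: continuous_horner.
- by move=> x _; rewrite derivE.
Qed.

Lemma Rintegral_int01 (p : {poly R}) :
  \int[mu]_(s in D) p.[(s - a) / (b - a)] = (b - a) * int01 p.
Proof.
pose L : {poly R} := (b - a)^-1 *: ('X - a%:P).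
have LE s : L.[s] = (s - a) / (b - a) by rewrite !hornerE mulrC.
have ba : b - a != 0 by rewrite subr_eq0 gt_eqF.
pose P := (b - a) *: (antideriv p \Po L).
have dP : P^`() = p \Po L.
  rewrite /P derivZ deriv_comp deriv_antideriv /L derivZ derivB derivX derivC subr0.
  by rewrite -scalerAr scalerA divff// scale1r mulr1.
have := Rintegral_deriv_poly P; rewrite dP.
under eq_Rintegral do rewrite horner_comp LE.
move=> ->; rewrite /P !hornerZ !horner_comp !LE subrr mul0r divff//.
by rewrite /int01 mulrBr.
Qed.

End AeBounded.

(** * Riesz representation *)
Section DotForms.
Context {R : realType} {H : completeNormedModType R} (ip : {dot H for idfun}).

Lemma dot_bilin : bilin (ip : H -> H -> R).
Proof.
split=> [u k v w|u k v w]; first by rewrite linearDr linearZr_LR.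
by rewrite /= linearDl linearZl_LR.
Qed.

Lemma dot_sym : symf (ip : H -> H -> R).
Proof. by move=> u v; rewrite hermC expr0 mul1r. Qed.

Lemma dot_psd : psd (ip : H -> H -> R).
Proof.
move=> u; have [->|u0] := eqVneq u 0; first by rewrite (bil0l dot_bilin).
exact/ltW/neq0_dnorm_gt0.
Qed.

Hypothesis ipN : induces_norm ip.

Lemma dot_norm_CS u v : `|ip u v| <= `|u| * `|v|.
Proof.
rewrite -ler_sqr ?nnegrE ?mulr_ge0// real_normK ?num_real// exprMn -!ipN.
exact: psd_CS dot_bilin dot_sym dot_psd u v.
Qed.

Section Riesz.
Variables (f : H -> R) (fl : scalar f) (B : R) (B0 : 0 <= B).
Hypothesis fB : forall u, f u ^+ 2 <= B * ip u u.

(** The representative of f minimizes this functional: if f = (r, .), then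
    phi v = |v - r|^2 - |r|^2. *)
Let phi v := ip v v - 2 * f v.

Let phi_lb v : - B <= phi v.
Proof.
have : 2 * f v <= ip v v + B; last by rewrite /phi; lra.
rewrite (le_trans (ler_norm _))// -ler_sqr ?nnegrE ?addr_ge0 ?dot_psd//.
rewrite real_normK ?num_real// exprMn.
by have := fB v; have := sqr_ge0 (ip v v - B); lra.
Qed.

Let m := inf (range phi).

Let phi_inf : has_inf (range phi).
Proof.
split; first by exists (phi 0), 0.
by exists (- B) => _ [v _ <-]; exact: phi_lb.
Qed.

Let m_le v : m <= phi v.
Proof. by apply: ge_inf; [case: phi_inf|exists v]. Qed.

(** Parallelogram identity at the midpoint, where phi is at least m. *)
Let phi_dist u v : `|u - v| ^+ 2 <= 2 * (phi u + phi v - 2 * m).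
Proof.
have := m_le (2^-1 *: (u + v)); rewrite /phi -ipN.
have bl := dot_bilin; rewrite (bilZl bl) (bilZr bl) (scalar_funZ fl) (scalar_funD fl).
by rewrite (bilBl bl) !(bilBr bl) (bilDl bl) !(bilDr bl) (dot_sym v u); lra.
Qed.

(** A minimizing sequence is Cauchy by [phi_dist].  Comparing phi at v_n and at
    v_n + t u for all t bounds ((v_n, u) - f u)^2 by |u|^2 / (n + 1), so that the
    limit of the sequence represents f without evaluating phi there. *)
Lemma riesz_representation : exists r, forall u, f u = ip r u.
Proof.
have bl := dot_bilin.
have [v vP] : exists v : nat -> H, forall n, phi (v n) < m + n.+1%:R^-1.
  suff /choice[v vP] : forall n : nat, exists u, phi u < m + n.+1%:R^-1 by exists v.
  move=> n; have n0 : 0 < n.+1%:R^-1 :> R by rewrite invr_gt0.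
  by have [_ [u _ <-] hu] := inf_adherent n0 phi_inf; exists u.
have near_eq n u : (ip (v n) u - f u) ^+ 2 <= n.+1%:R^-1 * ip u u.
  apply: young_sq; rewrite ?invr_ge0 ?dot_psd// => th th0.
  have E t : 0 <= n.+1%:R^-1 + 2 * (t * (ip (v n) u - f u)) + t ^+ 2 * ip u u.
    have := m_le (v n + t *: u); have := vP n; rewrite /phi.
    rewrite (bilDl bl) !(bilDr bl) !(bilZl bl) !(bilZr bl) (scalar_funD fl) (scalar_funZ fl).
    by rewrite (dot_sym u (v n)); move: (n.+1%:R^-1) => k; lra.
  set d := ip (v n) u - f u in E *; set k := n.+1%:R^-1 in E *.
  have F t : 0 <= th * (k + 2 * (t * d) + t ^+ 2 * ip u u) by rewrite mulr_ge0// ltW.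
  have F1 : 0 <= th * k + 2 * d + th^-1 * ip u u.
    rewrite (_ : _ + _ = th * (k + 2 * (th^-1 * d) + th^-1 ^+ 2 * ip u u))//.
    by field; rewrite gt_eqF.
  have F2 : 0 <= th * k - 2 * d + th^-1 * ip u u.
    rewrite (_ : _ + _ = th * (k + 2 * ((- th^-1) * d) + (- th^-1) ^+ 2 * ip u u))//.
    by field; rewrite gt_eqF.
  by case: (ger0P d) => _; lra.
have cvg_v : cvg (v n @[n --> \oo]).
  apply: cauchy_cvg; apply: cauchy_exP => e e0.
  pose n := Num.bound (4 / e ^+ 2).
  have ne : 4 * n.+1%:R^-1 < e ^+ 2.
    rewrite ltr_pdivrMr ?ltr0n// mulrC -ltr_pdivrMr ?exprn_gt0//.
    rewrite (lt_trans (archi_boundP _))// ?ltr_nat// divr_ge0// exprn_ge0// ltW//.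
  exists (v n); exists n => // k /= nk; rewrite -ball_normE /=.
  rewrite -ltr_sqr ?nnegrE ?(ltW e0)//; apply: le_lt_trans ne.
  apply: (le_trans (phi_dist _ _)).
  have kn : k.+1%:R^-1 <= n.+1%:R^-1 :> R by rewrite lef_pV2 ?posrE// ler_nat ltnS.
  by have := vP n; have := vP k; move: kn; move: (n.+1%:R^-1) (k.+1%:R^-1) => x y; lra.
pose r := lim (v n @[n --> \oo]).
exists r => u; apply/eqP; rewrite -subr_eq0; apply/negPn/negP => fru.
have d0 : 0 < `|f u - ip r u| by rewrite normr_gt0.
have : (ip (v n) u - f u)^+2 @[n --> \oo] --> (ip r u - f u) ^+ 2.
  have C : ip (v n) u @[n --> \oo] --> ip r u.
    apply/cvgrPdist_le => e e0.
    have : \forall n \near \oo, `|r - v n| <= e / (`|u| + 1).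
      by move/cvgrPdist_le : cvg_v; apply; rewrite divr_gt0// ltr_wpDl.
    apply: filterS => n hn; rewrite -(bilBl bl).
    apply: (le_trans (dot_norm_CS _ _)).
    apply: (@le_trans _ _ (e / (`|u| + 1) * `|u|)); first by rewrite ler_wpM2r.
    rewrite mulrAC ler_pdivrMr ?ltr_wpDl// ler_wpM2l ?(ltW e0)//; lra.
  have C' : ip (v n) u - f u @[n --> \oo] --> ip r u - f u.
    by apply: cvgB => //; exact: cvg_cst.
  by under eq_fun do rewrite expr2; rewrite expr2; exact: cvgM.
move=> C2; have : (ip r u - f u) ^+ 2 <= 0.
  have C0 : (n.+1%:R^-1 * ip u u) @[n --> \oo] --> (0 : R).
    rewrite -[X in _ --> X](mul0r (ip u u)); apply: cvgMl.
    exact: cvg_harmonic.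
  by apply: (ler_cvg_to C2 C0); apply: nearW => n; exact: near_eq.
rewrite lt_geF// exprn_even_gt0//=.
by rewrite subr_eq0 eq_sym -subr_eq0.
Qed.
End Riesz.
End DotForms.

(** * Derivatives, traces and dual norms *)
Section Derivatives.
Context {R : realType} {V : normedModType R}.

Lemma is_derive_scalel (f : R -> R) (c : V) (x df : R) :
  is_derive x 1 f df -> is_derive x 1 (fun s => f s *: c) (df *: c).
Proof.
move=> [fx fdf].
have E : (fun h : R => h^-1 *: (f (h *: 1 + x) *: c - f x *: c)) =
         (fun h : R => (h^-1 *: (f (h *: 1 + x) - f x)) *: c).
  by apply/funext => h; rewrite -scalerBl scalerA.
have C : (h^-1 *: (f (h *: 1 + x) *: c - f x *: c)) @[h --> 0^'] --> df *: c.
  by rewrite E; apply: cvgZl; rewrite -fdf; exact: fx.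
split; first by apply/cvg_ex; exists (df *: c); exact: C.
exact/cvg_lim.
Qed.

Lemma is_derive_horner (p : {poly R}) (x : R) : is_derive x 1 (horner p) p^`().[x].
Proof. by split; [exact: derivable_horner|rewrite -derive1E -derivE]. Qed.

Lemma is_derive_peval q (c : nat -> V) (a t x : R) :
  is_derive x 1 (fun s => peval q c ((s - a) / t)) (t^-1 *: peval q (pderiv q c) ((x - a) / t)).
Proof.
pose L : {poly R} := t^-1 *: ('X - a%:P).
have LE s : L.[s] = (s - a) / t by rewrite !hornerE mulrC.
have -> : (fun s => peval q c ((s - a) / t)) =
    \sum_(i < q.+1) (fun s => (L ^+ i).[s] *: c i).
  by apply/funext => s; rewrite fct_sumE; apply: eq_bigr => i _; rewrite horner_exp LE.
rewrite peval_der scaler_sumr; apply: is_derive_sum => i.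
rewrite scalerA.
have -> : t^-1 * (i%:R * ((x - a) / t) ^+ i.-1) = ((L ^+ i)^`()).[x].
  rewrite deriv_exp hornerMn hornerM horner_exp LE /L derivZ derivB derivX derivC.
  by rewrite subr0 hornerZ hornerC mulr1 -mulrnAr -[in RHS]mulr_natl.
by apply: is_derive_scalel; exact: is_derive_horner.
Qed.

Section OnSlab.
Variables (q : nat) (c : nat -> V) (w : R -> V) (a b : R).
Hypothesis ab : a < b.
Hypothesis wE : forall s, `]a, b]%classic s -> w s = peval q c ((s - a) / (b - a)).

Lemma slab_derive1 s : a < s < b ->
  derive1 w s = (b - a)^-1 *: peval q (pderiv q c) ((s - a) / (b - a)).
Proof.
move=> /andP[as_ sb]; rewrite derive1E.
have D := is_derive_peval q c a (b - a) s.
rewrite -(@derive_val _ _ _ _ _ _ _ D); apply: near_eq_derive.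
near=> z; apply: wE => /=; rewrite in_itv/=; apply/andP; split.
  by near: z; exact: lt_nbhsr.
by apply: ltW; near: z; exact: lt_nbhsl.
Unshelve. all: by end_near. Qed.

Lemma slab_vplus : lim (w s @[s --> a^'+]) = c 0%N.
Proof.
apply/cvg_lim => //.
have D := is_derive_peval q c a (b - a) a.
have C : {for a, continuous (fun s => peval q c ((s - a) / (b - a)))}.
  exact/differentiable_continuous/derivable1_diffP/(@ex_derive _ _ _ _ _ _ _ D).
have C' : (peval q c ((s - a) / (b - a))) @[s --> a^'+] --> c 0%N.
  by have /cvg_at_right_filter := C; rewrite subrr mul0r peval0.
apply: cvg_trans C'; apply: near_eq_cvg.
near=> z; apply/esym/wE => /=; rewrite in_itv/=; apply/andP; split.
  by near: z; exact: nbhs_right_gt.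
by near: z; exact: nbhs_right_le.
Unshelve. all: by end_near. Qed.

End OnSlab.
End Derivatives.

(** The supremum is attained at r.  If r = 0 it is the supremum of a set that is
    empty or {0}, according to whether V is trivial. *)
Lemma dual_norm_riesz (R : realType) (V : completeNormedModType R)
    (ip : {dot V for idfun}) (r : V) : induces_norm ip ->
  dual_norm (fun v => ip r v) = `|r|.
Proof.
move=> ipN; rewrite /dual_norm; set S := [set _ | _ in _].
have Sub x : S x -> x <= `|r|.
  move=> [v v0 <-]; rewrite ler_pdivrMr ?normr_gt0//; exact: dot_norm_CS.
have [r0|rN] := eqVneq r 0.
  have S0 x : S x -> x = 0.
    by move=> [v _ <-]; rewrite r0 (bil0l (dot_bilin ip)) normr0 mul0r.
  rewrite r0 normr0; have [->|/set0P[x Sx]] := eqVneq S set0; first exact: sup0.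
  have -> : S = [set 0].
    by apply/seteqP; split => y; [move/S0|move=> ->; rewrite -(S0 x)].
  by rewrite sup1.
have rS : S `|r|.
  by exists r => //=; rewrite ipN normrX normr_id expr2 mulfK// normr_eq0.
apply/eqP; rewrite eq_le; apply/andP; split.
  by apply: sup_le_ub; [exists (`|r|) | move=> x /Sub].
by apply: ub_le_sup => //; exists (`|r|) => x /Sub.
Qed.

(** * The operator on one element *)
Lemma ae_neq (R : realType) (b : R) : {ae (@lebesgue_measure R), forall s : R, s <> b}.
Proof.
exists [set b]; split; [exact: measurable_set1|exact: lebesgue_measure_set1|].
by move=> s /= /contrapT.
Qed.

Section OnSlabForm.
Context {R : realType} {V : completeNormedModType R} (ip : {dot V for idfun}).
Hypothesis ipN : induces_norm ip.
Variables (q : nat) (a b : R) (A : R -> V -> V -> R) (alpha M : R).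
Hypothesis ab : a < b.
Notation mu := (@lebesgue_measure R).
Notation D := (`]a, b]%classic : set R).
Hypothesis A_bdd : forall u v, ae_bounded a b (fun s => A s u v).
Hypothesis A_lin : {ae mu, forall s, D s -> linear_to_dual (A s)}.
Hypothesis A_M : {ae mu, forall s, D s ->
  forall w v : V, `|A s w v| <= M * `|w| * `|v|}.
Hypothesis A_alpha : {ae mu, forall s, D s ->
  forall v : V, alpha * `|v| ^+ 2 <= A s v v}.
Hypothesis M_gt0 : 0 < M.

Let x s := (s - a) / (b - a).

Definition slab_form (c d : nat -> V) : R :=
  \int[mu]_(s in D) A s (peval q c (x s)) (peval q d (x s)).

Lemma linear_to_dual_bilin (B : V -> V -> R) : linear_to_dual B -> bilin B.
Proof.
move=> [l r]; split=> [u|u k v w]; first exact: (l u).1.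
by rewrite /= r.
Qed.

Lemma ae_bounded_x k : ae_bounded a b (fun s => x s ^+ k).
Proof.
pose L : {poly R} := (b - a)^-1 *: ('X - a%:P).
rewrite (_ : (fun s => _) = horner (L ^+ k)); first exact: ae_bounded_poly.
by apply/funext => s; rewrite horner_exp /x /L !hornerE mulrC.
Qed.

Lemma ae_bounded_form (c d : nat -> V) :
  ae_bounded a b (fun s => A s (peval q c (x s)) (peval q d (x s))).
Proof.
pose F s := \sum_(i < q.+1) \sum_(j < q.+1) x s ^+ i * (x s ^+ j * A s (c i) (d j)).
apply: (@ae_bounded_ae _ _ _ _ F).
  apply: filterS A_lin => s + Ds => /(_ Ds) /linear_to_dual_bilin bl.
  rewrite (bil_suml bl); apply: eq_bigr => i _.
  rewrite (bilZl bl) (bil_sumr bl) mulr_sumr; apply: eq_bigr => j _.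
  by rewrite (bilZr bl).
apply: ae_bounded_sum => i; apply: ae_bounded_sum => j.
by apply: ae_boundedM; [exact: ae_bounded_x|apply: ae_boundedM; [exact: ae_bounded_x|]].
Qed.

Lemma slab_form_bilin : bilin slab_form.
Proof.
split=> [c k d e|d k c e]; rewrite /slab_form -ae_bounded_linear;
  try exact: ae_bounded_form; apply: Rintegral_ae;
  apply: filterS A_lin => s + Ds => /(_ Ds) /linear_to_dual_bilin bl.
  by rewrite peval_lin (bilDr bl) (bilZr bl).
by rewrite peval_lin (bilDl bl) (bilZl bl).
Qed.

Let g := (ip : V -> V -> R).
Notation sq c := (int01 (pform q g c c)).

Lemma ae_bounded_horner p : ae_bounded a b (fun s => p.[x s]).
Proof.
pose L : {poly R} := (b - a)^-1 *: ('X - a%:P).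
rewrite (_ : (fun s => _) = horner (p \Po L)); first exact: ae_bounded_poly.
by apply/funext => s; rewrite horner_comp /x /L !hornerE mulrC.
Qed.

Lemma slab_form_coercive c : alpha * ((b - a) * sq c) <= slab_form c c.
Proof.
rewrite mulrCA -int01Z -(Rintegral_int01 ab); apply: ae_le_Rintegral.
- exact: ae_bounded_horner.
- exact: ae_bounded_form.
- apply: filterS A_alpha => s + Ds => /(_ Ds) h.
  by rewrite hornerZ pform_horner; [rewrite /g ipN; exact: h|exact: dot_bilin].
Qed.

(** The bound without absolute value suffices, applied to c and to - c. *)
Lemma slab_form_bounded c d th : 0 < th ->
  2 * `|slab_form c d| <= M * (th * ((b - a) * sq c) + th^-1 * ((b - a) * sq d)).
Proof.
move=> th0; have gl := dot_bilin ip.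
have H e : slab_form e d <= 2^-1 * (M * (th * ((b - a) * sq e) + th^-1 * ((b - a) * sq d))).
  pose p := 2^-1 *: (M *: (th *: pform q g e e + th^-1 *: pform q g d d)).
  have -> : 2^-1 * (M * (th * ((b - a) * sq e) + th^-1 * ((b - a) * sq d))) =
            (b - a) * int01 p.
    by rewrite /p !int01Z int01D !int01Z; ring.
  rewrite -(Rintegral_int01 ab); apply: ae_le_Rintegral.
  - exact: ae_bounded_form.
  - exact: ae_bounded_horner.
  - apply: filterS A_M => s + Ds => /(_ Ds) h; apply: (le_trans (ler_norm _)).
    apply: (le_trans (h _ _)); rewrite /p !(hornerZ, hornerD) !pform_horner// -/(x s) /g !ipN.
    set u := `|_|; set v := `|_|.
    have : 2 * (u * v) <= th * u ^+ 2 + th^-1 * v ^+ 2.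
      have : 0 <= th^-1 * (th * u - v) ^+ 2 by rewrite mulr_ge0 ?sqr_ge0 ?invr_ge0 ?ltW.
      rewrite (_ : th^-1 * (th * u - v) ^+ 2 = th * u ^+ 2 + th^-1 * v ^+ 2 - 2 * (u * v)); first lra.
      by field; rewrite gt_eqF.
    by move/(ler_wpM2l (ltW M_gt0)); lra.
have E : sq (- c) = sq c.
  by rewrite [LHS](bilNl (pform_bilin q gl)) (bilNr (pform_bilin q gl)) opprK.
have := H c; have := H (- c); rewrite E (bilNl slab_form_bilin).
by case: (ger0P (slab_form c d)) => _; lra.
Qed.

End OnSlabForm.

(** * Functions of the discrete space and their coefficients *)
Section Reparam.
Context {R : realType} {V : lmodType R}.

(** Expand (a + b x)^i: this converts between powers of s and powers of
    (s - t_n) / tau, in both directions. *)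
Lemma peval_affine q (c : nat -> V) (a b : R) :
  exists d, forall x, peval q c (a + b * x) = peval q d x.
Proof.
pose P i : {poly R} := (a%:P + b *: 'X) ^+ i.
have PE i x : (P i).[x] = (a + b * x) ^+ i by rewrite horner_exp !hornerE.
have Ps i : (i < q.+1)%N -> (size (P i) <= q.+1)%N.
  move=> iq; apply: (leq_trans (size_poly_exp_leq _ _)).
  have : (size (a%:P + b *: 'X)%R <= 2)%N.
    rewrite (leq_trans (size_polyD _ _))// geq_max (leq_trans (size_polyC_leq1 _))//=.
    by rewrite (leq_trans (size_scale_leq _ _))// size_polyX.
  by case: (size _) => [|[|[|]]]// _; rewrite ?mul0n ?mul1n.
exists (fun k => \sum_(i < q.+1) (P i)`_k *: c i) => x.
transitivity (\sum_(i < q.+1) \sum_(k < q.+1) ((P i)`_k * x ^+ k) *: c i).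
  apply: eq_bigr => i _; rewrite -PE (horner_coef_wide _ (Ps i (ltn_ord i))).
  by rewrite scaler_suml.
rewrite exchange_big/=; apply: eq_bigr => k _; rewrite scaler_sumr.
by apply: eq_bigr => i _; rewrite scalerA mulrC.
Qed.

End Reparam.

Section Partition.
Context {R : realType} {V : completeNormedModType R}.
Variables (T : R) (N : nat) (t : nat -> R) (q : nat).
Hypothesis tP : is_partition T N t.

Lemma partition_step n : (n < N)%N -> t n < t n.+1.
Proof. by case: tP => _ _; apply. Qed.

Lemma step_gt0 n : (n < N)%N -> 0 < step t n.
Proof. by move=> nN; rewrite subr_gt0 partition_step. Qed.

Lemma partition_le n m : (n <= m)%N -> (m <= N)%N -> t n <= t m.
Proof.
elim: m => [|m IH]; first by rewrite leqn0 => /eqP ->.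
rewrite leq_eqVlt => /orP[/eqP ->//|]; rewrite ltnS => nm mN.
by rewrite (le_trans (IH nm (ltnW mN)))// ltW// partition_step.
Qed.

Lemma J_inside n s : (n < N)%N -> J t n s -> s <> t n.+1 -> `]0, T[%classic s.
Proof.
case: (tP) => t0 tN _ nN; rewrite /J/= !in_itv/= => /andP[s1 s2] sN.
have := partition_le (leq0n n) (ltnW nN); rewrite t0 => h0.
have := partition_le nN (leqnn N); rewrite tN => h1.
rewrite (le_lt_trans h0 s1)/= (lt_le_trans _ h1)// lt_neqAle s2 andbT.
exact/eqP.
Qed.

Lemma J_sub n s : (n < N)%N -> J t n s -> `]0, T]%classic s.
Proof.
case: (tP) => t0 tN _ nN; rewrite /J/= !in_itv/= => /andP[s1 s2].
have := partition_le (leq0n n) (ltnW nN); rewrite t0 => h0.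
have := partition_le nN (leqnn N); rewrite tN => h1.
by rewrite (le_lt_trans h0 s1) (le_trans s2 h1).
Qed.

Lemma J_cover s : `]0, T]%classic s -> exists2 n, (n < N)%N & J t n s.
Proof.
case: tP => t0 tN _; rewrite /= in_itv/= -t0 -tN => /andP[s0].
elim: N => [|m IH]; first by rewrite leNgt s0.
have [sm _|ms sm1] := leP s (t m).
  by have [n nm Jn] := IH sm; exists n => //; rewrite ltnW.
by exists m => //; rewrite /J/= in_itv/= ms sm1.
Qed.

Lemma J_disjoint n m s : (n < N)%N -> (m < N)%N -> J t n s -> J t m s -> n = m.
Proof.
rewrite /J/= !in_itv/= => nN mN /andP[n1 n2] /andP[m1 m2].
apply/eqP; rewrite eqn_leq; apply/andP; split; rewrite leqNgt; apply/negP => l.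
  by have := partition_le l (ltnW nN); rewrite leNgt (lt_le_trans n1 m2).
by have := partition_le l (ltnW mN); rewrite leNgt (lt_le_trans m1 n2).
Qed.

Definition represents (w : R -> V) (C : nat -> nat -> V) : Prop :=
  forall n, (n < N)%N -> forall s, J t n s -> w s = peval q (C n) ((s - t n) / step t n).

Lemma Stau_represents w : Stau q N t w -> exists C, represents w C.
Proof.
move=> wS; suff /choice[C CP] : forall n, exists c, (n < N)%N -> forall s, J t n s ->
    w s = peval q c ((s - t n) / step t n) by exists C.
move=> n; have [nN|] := boolP (n < N)%N; last by exists 0.
have [c infsup_const] := wS n nN.
have [d dP] := peval_affine q (fun i => c (inord i)) (t n) (step t n).
exists d => _ s Js; rewrite infsup_const// -dP mulrC divfK ?gt_eqF ?step_gt0//.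
rewrite addrC subrK; apply: eq_bigr => i _; by rewrite inord_val.
Qed.

Lemma represents_Stau w C : represents w C -> Stau q N t w.
Proof.
move=> wC n nN.
have [d dP] := peval_affine q (C n) (- t n / step t n) (step t n)^-1.
exists (fun i => d i) => s Js; rewrite (wC n nN s Js) -/(peval q d s) -dP.
by congr (peval _ _ _); ring.
Qed.

(** The elements are disjoint, so the sum of the pieces extended by zero has the
    prescribed piece on each. *)
Lemma represented C : exists w, represents w C.
Proof.
exists (fun s => \sum_(n < N) if `[< J t n s >] then peval q (C n) ((s - t n) / step t n) else 0).
move=> n nN s Js; rewrite (bigD1 (Ordinal nN))//= asboolT// big1 ?addr0// => m mn.
rewrite asboolF// => Jm; move/eqP: mn; apply; apply: val_inj => /=.
exact: J_disjoint Jm Js.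
Qed.

Section Represented.
Variables (w : R -> V) (C : nat -> nat -> V).
Hypothesis wC : represents w C.

Lemma represents_vplus n : (n < N)%N -> vplus t w n = C n 0%N.
Proof. by move=> nN; exact: (slab_vplus (partition_step nN) (wC nN)). Qed.

Lemma represents_node n : (n < N)%N -> w (t n.+1) = peval q (C n) 1.
Proof.
move=> nN; rewrite (wC nN) ?divff ?gt_eqF ?step_gt0//.
by rewrite /J/= in_itv/= lexx partition_step.
Qed.

Lemma represents_jump n : (0 < n < N)%N -> jump t w n = C n 0%N - peval q (C n.-1) 1.
Proof.
case: n => // n /= nN; rewrite /jump represents_vplus// represents_node//.
exact: ltnW.
Qed.

(** At the right end of an element the two-sided derivative may not exist. *)
Lemma represents_derive1 n : (n < N)%N -> {ae (@lebesgue_measure R), forall s, J t n s ->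
  derive1 w s = (step t n)^-1 *: peval q (pderiv q (C n)) ((s - t n) / step t n)}.
Proof.
move=> nN; apply: filterS (ae_neq (t n.+1)) => s sN Js.
apply: (slab_derive1 (wC nN)).
move: Js; rewrite /J/= in_itv/= => /andP[-> s1]/=.
by rewrite lt_neqAle s1 andbT; apply/eqP.
Qed.

End Represented.
End Partition.

(** * Reduction to coefficients *)
Section Reduction.
Context {R : realType} {H V : completeNormedModType R}.
Variables (ipH : {dot H for idfun}) (ipV : {dot V for idfun}).
Hypotheses (ipH_norm : induces_norm ipH) (ipV_norm : induces_norm ipV).
Variables (iota : {linear V -> H}) (alpha M K T : R) (q N : nat) (t : nat -> R).
Hypothesis iota_bounded : forall v : V, `|iota v| <= K * `|v|.
Hypothesis tP : is_partition T N t.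
Variable A : R -> V -> V -> R.
Hypothesis A_meas : forall w v : V, Lmeasurable_fun `]0, T[ (fun s => A s w v).
Hypothesis A_linear : {ae (@lebesgue_measure R), forall s : R, `]0, T[%classic s ->
  linear_to_dual (A s)}.
Hypothesis A_bounded : {ae (@lebesgue_measure R), forall s : R, `]0, T[%classic s ->
  forall w v : V, `|A s w v| <= M * `|w| * `|v|}.
Hypothesis A_coercive : {ae (@lebesgue_measure R), forall s : R, `]0, T[%classic s ->
  forall v : V, alpha * `|v| ^+ 2 <= A s v v}.
Hypotheses (M_gt0 : 0 < M) (T_gt0 : 0 < T).

Notation mu := (@lebesgue_measure R).
Notation g := (ipV : V -> V -> R).

Definition hform (u v : V) : R := ipH (iota u) (iota v).

Lemma hform_bilin : bilin hform.
Proof.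
have bl := dot_bilin ipH.
by split=> [u k v w|u k v w]; rewrite /hform linearP ?(bilDr bl) ?(bilDl bl)
  ?(bilZr bl) ?(bilZl bl).
Qed.

Lemma hform_sym : symf hform. Proof. by move=> u v; exact: dot_sym. Qed.
Lemma hform_psd : psd hform. Proof. by move=> u; exact: dot_psd. Qed.

Lemma hform_le u : hform u u <= K ^+ 2 * g u u.
Proof.
rewrite /hform ipH_norm ipV_norm -exprMn ler_sqr ?nnegrE//.
exact: le_trans (iota_bounded u).
Qed.

Lemma dot_eq0 u : g u u = 0 -> u = 0.
Proof. by rewrite ipV_norm => /eqP; rewrite sqrf_eq0 normr_eq0 => /eqP. Qed.

Lemma riesz_dot (f : V -> R) : scalar f -> (exists B, forall u, f u ^+ 2 <= B * g u u) ->
  exists r, forall u, f u = g r u.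
Proof.
move=> fl [B fB]; apply: (riesz_representation ipV_norm fl (normr_ge0 B)) => u.
by rewrite (le_trans (fB u))// ler_wpM2r ?dot_psd// ler_norm.
Qed.

(** Linearity follows from uniqueness of the representative. *)
Lemma riesz_map : exists rho : V -> V,
  (forall k u v, rho (k *: u + v) = k *: rho u + rho v) /\
  (forall u v, g (rho u) v = hform u v).
Proof.
have /choice[rho rhoP] : forall u, exists r, forall v, hform u v = g r v.
  move=> u; apply: riesz_dot; first exact: hform_bilin.1.
  exists (hform u u * K ^+ 2) => v.
  apply: (le_trans (psd_CS hform_bilin hform_sym hform_psd u v)).
  by rewrite -mulrA ler_wpM2l ?hform_psd ?hform_le.
exists rho; split=> [k u v|u v]; last by rewrite rhoP.
have gl := dot_bilin ipV; apply/eqP; rewrite -subr_eq0; apply/eqP/dot_eq0.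
set z := _ - _; rewrite {1}/z (bilBl gl) (bilDl gl) (bilZl gl) -!rhoP.
by rewrite (bilDl hform_bilin) (bilZl hform_bilin) subrr.
Qed.

Lemma ae_slab (P : R -> Prop) n : (n < N)%N ->
  {ae mu, forall s, `]0, T[%classic s -> P s} -> {ae mu, forall s, J t n s -> P s}.
Proof.
move=> nN HP; apply: (filterS2 _ _ HP (ae_neq (t n.+1))) => s + sN Js.
by apply; exact: J_inside nN Js sN.
Qed.

(** Truncating the Borel representative of s |-> A s u v at the height M |u| |v|
    makes it bounded everywhere and changes it on a null set only. *)
Lemma ae_bounded_A n u v : (n < N)%N -> ae_bounded (t n) (t n.+1) (fun s => A s u v).
Proof.
move=> nN; have [G mG AG] := A_meas u v.
pose B := `|M * `|u| * `|v| |.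
pose G0 := G \_ `]0, T[.
exists (fun s => Num.max (- B) (Num.min B (G0 s))).
  split; last first.
    exists B => s _; rewrite ler_norml le_max lexx/= ge_max ge_min lexx/= andbT.
    by have := normr_ge0 (M * `|u| * `|v|); rewrite -/B; lra.
  apply: measurable_maxr; first exact: measurable_cst.
  apply: measurable_minr; first exact: measurable_cst.
  have : measurable_fun setT G0 by apply/(measurable_restrictT _ _).1.
  exact: measurable_funS.
have AB : {ae mu, forall s, `]0, T[%classic s -> A s u v = Num.max (- B) (Num.min B (G0 s))}.
  apply: (filterS2 _ _ AG A_bounded) => s + + Ts => /(_ Ts) AE /(_ Ts) /(_ u v) h.
  rewrite /G0 patchE mem_set// -AE.
  have {h} : `|A s u v| <= B by rewrite (le_trans h)// ler_norm.
  by rewrite ler_norml => /andP[h1 h2]; rewrite min_r// max_r.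
exact: ae_slab nN AB.
Qed.

Definition aform n := slab_form q (t n) (t n.+1) A.

Lemma N_gt0 : (0 < N)%N.
Proof.
case: tP => t0 tN _; rewrite lt0n; apply/eqP => N0; move: T_gt0.
by rewrite -tN N0 t0 ltxx.
Qed.

Lemma aform_bilin n : (n < N)%N -> bilin (aform n).
Proof.
move=> nN; apply: slab_form_bilin; first by move=> u v; exact: ae_bounded_A.
exact: ae_slab nN A_linear.
Qed.

Lemma aform_coercive n c : (n < N)%N ->
  alpha * (step t n * int01 (pform q g c c)) <= aform n c c.
Proof.
move=> nN; apply: slab_form_coercive => //.
- exact: partition_step tP _ nN.
- by move=> u v; exact: ae_bounded_A.
- exact: ae_slab nN A_linear.
- exact: ae_slab nN A_coercive.
Qed.

Lemma aform_bounded n c d th : (n < N)%N -> 0 < th -> 2 * `|aform n c d| <=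
  M * (th * (step t n * int01 (pform q g c c)) + th^-1 * (step t n * int01 (pform q g d d))).
Proof.
move=> nN th0; apply: slab_form_bounded => //.
- exact: partition_step tP _ nN.
- by move=> u v; exact: ae_bounded_A.
- exact: ae_slab nN A_linear.
- exact: ae_slab nN A_bounded.
Qed.

Notation represents := (represents N t q).

Lemma Btau_dg_form w v C D : represents w C -> represents v D ->
  Btau ipH iota A N t w v = dg_form q hform N aform C D.
Proof.
move=> wC vD; rewrite /Btau /dg_form; congr (_ + _ + _).
- apply: eq_big_nat => n /andP[_ nN]; have tp := step_gt0 tP nN.
  have bt := partition_step tP nN.
  pose p := pform q hform (pderiv q (C n)) (D n).
  rewrite (@Rintegral_ae _ (t n) (t n.+1) _ (fun s =>
    (step t n)^-1 * p.[(s - t n) / step t n] +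
    A s (peval q (C n) ((s - t n) / step t n)) (peval q (D n) ((s - t n) / step t n)))).
    rewrite ae_bounded_linear; [|exact: ae_bounded_horner|]; last first.
      apply: ae_bounded_form; first by move=> u v'; exact: ae_bounded_A.
      exact: ae_slab nN A_linear.
    by rewrite (Rintegral_int01 bt) mulKf// gt_eqF.
  apply: filterS (represents_derive1 wC nN) => s + Js => /(_ Js) ->.
  rewrite (wC n nN s Js) (vD n nN s Js) /p pform_horner; last exact: hform_bilin.
  by rewrite -(bilZl hform_bilin).
- by rewrite (represents_vplus tP wC) ?(represents_vplus tP vD) ?N_gt0.
- apply: eq_big_nat => n nN; rewrite (represents_jump tP wC nN).
  by rewrite (represents_vplus tP vD)//; case/andP: nN.
Qed.

Lemma hform_norm u : hform u u = `|iota u| ^+ 2.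
Proof. exact: ipH_norm. Qed.

Section Norms.
Variable rho : V -> V.
Hypothesis rho_lin : forall k u v, rho (k *: u + v) = k *: rho u + rho v.
Hypothesis rhoP : forall u v, g (rho u) v = hform u v.

(** The functional v |-> (iota u, iota v) is represented by rho u in V. *)
Lemma dual_norm_rho u : dual_norm (to_dual ipH iota (iota u)) = `|rho u|.
Proof.
rewrite -(dual_norm_riesz (rho u) ipV_norm); congr dual_norm.
by apply/funext => v; rewrite rhoP.
Qed.

Lemma int_normY_int_Y w C : represents w C -> int_normY N t w = int_Y q g N (step t) C.
Proof.
move=> wC; apply: eq_big_nat => n /andP[_ nN].
rewrite -(Rintegral_int01 (partition_step tP nN)); apply: Rintegral_ae.
apply: aeW => s Js; rewrite (wC n nN s Js) pform_horner ?ipV_norm//.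
exact: dot_bilin.
Qed.

Lemma int_normX_int_X w C : represents w C ->
  int_normX ipH iota N t w = int_X q g rho N (step t) C.
Proof.
move=> wC; apply: eq_big_nat => n /andP[_ nN].
have tp := step_gt0 tP nN; have gl := dot_bilin ipV.
pose p := (step t n)^-1 ^+ 2 *: pform q g (riesz_deriv q rho (C n)) (riesz_deriv q rho (C n)) +
  pform q g (C n) (C n).
transitivity (step t n * int01 p); last first.
  by rewrite /p int01D int01Z mulrDr mulrA expr2 mulrA mulfV ?gt_eqF// mul1r.
rewrite -(Rintegral_int01 (partition_step tP nN)); apply: Rintegral_ae.
apply: filterS (represents_derive1 wC nN) => s + Js => /(_ Js) ->.
rewrite (wC n nN s Js) dual_norm_rho /p hornerD hornerZ !pform_horner// !ipV_norm.
congr (_ + _); rewrite peval_riesz_deriv// rhoZ// normrZ exprMn.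
by rewrite real_normK ?num_real.
Qed.

Lemma jump_sum_jumps w C : represents w C -> jump_sum iota N t w = jumps q hform N C.
Proof.
move=> wC; apply: eq_big_nat => n nN.
by rewrite (represents_jump tP wC nN) hform_norm.
Qed.

Lemma weighted_sum_weighted w C : represents w C ->
  weighted_sum iota N t w = weighted hform N (step t) C.
Proof.
move=> wC; apply: eq_big_nat => n /andP[_ nN].
by rewrite (represents_vplus tP wC nN) hform_norm.
Qed.

Lemma initial_norm w C : represents w C -> `|iota (vplus t w 0)| ^+ 2 = initial hform C.
Proof. by move=> wC; rewrite (represents_vplus tP wC) ?N_gt0// -hform_norm. Qed.

Lemma final_norm w C : represents w C -> `|iota (w (t N))| ^+ 2 = final q hform N C.
Proof.
move=> wC; have N0 := N_gt0; rewrite -{1}(prednK N0) (represents_node tP wC) ?prednK//.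
by rewrite -hform_norm.
Qed.

Lemma normX_X_sq w C : represents w C ->
  normX ipH iota N t w = Num.sqrt (X_sq q g hform rho N (step t) C).
Proof. by move=> wC; rewrite /normX (int_normX_int_X wC) (initial_norm wC) (jump_sum_jumps wC). Qed.

Lemma normY_Y_sq w C : represents w C ->
  normY iota N t w = Num.sqrt (Y_sq q g hform N (step t) C).
Proof. by move=> wC; rewrite /normY (int_normY_int_Y wC) (initial_norm wC) (weighted_sum_weighted wC). Qed.

Lemma tnormX_Xt_sq w C : represents w C ->
  tnormX ipH iota N t w = Num.sqrt (Xt_sq q g hform rho N (step t) C).
Proof. by move=> wC; rewrite /tnormX (int_normX_int_X wC) (final_norm wC) (jump_sum_jumps wC). Qed.

Lemma tnormY_Yt_sq w C : represents w C ->
  tnormY iota N t w = Num.sqrt (Yt_sq q g hform N (step t) C).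
Proof. by move=> wC; rewrite /tnormY (int_normY_int_Y wC) (final_norm wC) (weighted_sum_weighted wC). Qed.

End Norms.
End Reduction.

(** * The two inf-sup inequalities *)
Unset Implicit Arguments.

Lemma inf_sup_ge {R : realType} {F : Type} (S : set F) (B : F -> F -> R)
    (nW nV : F -> R) (c : R) :
  (forall w, S w -> exists2 v, S v & c <= B w v / (nW w * nV v)) ->
  (c%:E <= inf_sup S B nW nV)%E.
Proof.
move=> H; apply/le_ereal_inf_tmp => _ [w /H[v Sv cv] <-].
apply: (@le_trans _ _ (B w v / (nW w * nV v))%:E); first by rewrite lee_fin.
by apply: ereal_sup_ubound; exists v.
Qed.

Lemma inf_sup_le {R : realType} {F : Type} (S : set F) (B : F -> F -> R)
    (nW nV : F -> R) (L : R) (w : F) : S w ->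
  (forall v, S v -> B w v / (nW w * nV v) <= L) ->
  (inf_sup S B nW nV <= L%:E)%E.
Proof.
move=> Sw H; apply: (@le_trans _ _ (ereal_sup [set (B w v / (nW w * nV v))%:E | v in S])).
  by apply: ereal_inf_lbound; exists w.
by apply/ge_ereal_sup => _ [v /H h <-]; rewrite lee_fin.
Qed.

(** The bound b <= L * y rules out y = 0, for which the quotient would be 0. *)
Lemma quotient_ge {R : realType} (b x y c L : R) : 0 < b -> 0 < x -> 0 <= y ->
  c * (x * y) <= b -> b <= L * y -> c <= b / (x * y).
Proof.
move=> b0 x0 y0 h1 h2; rewrite ler_pdivlMr// mulr_gt0// lt_neqAle y0 andbT eq_sym.
by apply: contraTN b0 => /eqP y_eq0; rewrite -leNgt (le_trans h2)// y_eq0 mulr0.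
Qed.

Lemma quotient_le {R : realType} (b x y L : R) : 0 < x -> 0 <= y ->
  0 <= L -> b <= L * y -> b / (x * y) <= L / x.
Proof.
move=> x0 y0 L0 h; have [->|yN] := eqVneq y 0.
  by rewrite mulr0 invr0 mulr0 divr_ge0// ltW.
have yp : 0 < y by rewrite lt_neqAle eq_sym yN y0.
rewrite ler_pdivrMr ?mulr_gt0// mulrA divfK ?gt_eqF//.
Qed.

Theorem theorem3 (R : realType) (alpha M K : R) (q : nat)
    (alpha_gt0 : 0 < alpha) (M_gt0 : 0 < M) :
  exists c1 c2 : R, [/\ 0 < c1, 0 < c2 &
  forall (H V : completeNormedModType R)
    (ipH : {dot H for idfun}) (ipV : {dot V for idfun})
    (ipH_norm : induces_norm ipH) (ipV_norm : induces_norm ipV)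
    (iota : {linear V -> H})
    (iota_inj : injective iota)
    (iota_dense : dense (range iota))
    (iota_bounded : forall v : V, `|iota v| <= K * `|v|)
    (T : R) (T_gt0 : 0 < T)
    (A : R -> V -> V -> R)
    (A_meas : forall w v : V, Lmeasurable_fun `]0, T[ (fun s => A s w v))
    (A_linear : {ae (@lebesgue_measure R), forall s : R, `]0, T[%classic s ->
       linear_to_dual (A s)})
    (A_bounded : {ae (@lebesgue_measure R), forall s : R, `]0, T[%classic s ->
       forall w v : V, `|A s w v| <= M * `|w| * `|v|})
    (A_coercive : {ae (@lebesgue_measure R), forall s : R, `]0, T[%classic s ->
       forall v : V, alpha * `|v| ^+ 2 <= A s v v})
    (N : nat) (t : nat -> R)
    (t_partition : is_partition T N t) (mesh_le1 : mesh N t <= 1),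
  let S := Stau q N t `&` nonzero_on T in
  let B := Btau ipH iota A N t in
  let is1 := inf_sup S B (normX ipH iota N t) (normY iota N t) in
  let is2 := inf_sup S B (tnormY iota N t) (tnormX ipH iota N t) in
  [/\ (c1%:E <= is1)%E, (c2%:E <= is2)%E &
      (exists v : V, v != 0) -> is1 \is a fin_num /\ is2 \is a fin_num]].
Proof.
have [C0 C0_ge1 C0P] := @coef_bound R q.
exists (infsup_const q alpha M K C0), (adjoint_infsup_const q alpha M K C0); split; [exact: infsup_const_gt0|exact: adjoint_infsup_const_gt0|].
move=> H V ipH ipV ipH_norm ipV_norm iota _ _ iota_bounded T T_gt0 A A_meas A_linear
  A_bounded A_coercive N t tP _ S B is1 is2.
have gl := dot_bilin ipV; have gs := dot_sym ipV; have gp := dot_psd ipV.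
have hl := hform_bilin ipH iota; have hs := hform_sym ipH iota.
have hp := hform_psd ipH iota; have hK := hform_le ipH_norm ipV_norm iota_bounded.
have [rho [rho_lin rhoP]] := riesz_map ipH_norm ipV_norm iota_bounded.
have C0g := C0P V ipV gl gs gp.
have N0 := N_gt0 tP T_gt0; have tau0 := step_gt0 tP.
pose a := aform q t A.
have al n (nN : (n < N)%N) : bilin (a n).
  exact: (aform_bilin q tP A_meas A_linear A_bounded nN).
have ac n c (nN : (n < N)%N) := aform_coercive ipV_norm q tP A_meas A_linear A_bounded A_coercive c nN.
have ab n c d th (nN : (n < N)%N) (th0 : 0 < th) :=
  aform_bounded ipV_norm q tP A_meas A_linear A_bounded M_gt0 c d nN th0.
have primal := infsup_primal alpha_gt0 M_gt0 C0_ge1 gl gs gp hl hs hp hK rho_lin rhoP C0g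
  N0 tau0 al ac ab.
have dual := infsup_adjoint alpha_gt0 M_gt0 C0_ge1 gl gs gp hl hs hp hK rho_lin rhoP C0g
  N0 tau0 al ac ab (riesz_dot ipV_norm).
have bnd := dg_form_right_bounded rho M_gt0 C0_ge1 gl gs gp hl hs hp hK C0g N0 tau0 al ab.
have bbl := (dg_form_bdd M_gt0 gl gs gp hl hs hp hK N0 tau0 al ab).1.
have repB := Btau_dg_form (q := q) ipH iota tP A_meas A_linear A_bounded T_gt0.
have nX := normX_X_sq (q := q) ipH_norm ipV_norm tP T_gt0 rho_lin rhoP.
have nY := normY_Y_sq (q := q) ipH_norm ipV_norm iota tP T_gt0.
have ntX := tnormX_Xt_sq (q := q) ipH_norm ipV_norm tP T_gt0 rho_lin rhoP.
have ntY := tnormY_Yt_sq (q := q) ipH_norm ipV_norm iota tP T_gt0.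
have iY0 w C : represents N t q w C -> nonzero_on T w -> 0 < int_Y q ipV N (step t) C.
  move=> wC [s Ts ws]; rewrite lt_neqAle (int_Y_ge0 q gl gp tau0)// andbT eq_sym.
  apply/eqP => C_eq0; have [n nN Js] := J_cover tP Ts.
  move: ws; rewrite (wC n nN s Js).
  by rewrite (int_Y_eq0 C0_ge1 gl gp C0g N0 tau0 (dot_eq0 ipV_norm) C_eq0)// eqxx.
(* a coefficient array with dg_form C D > 0 is nonzero, as is its function *)
have realize w C D : represents N t q w C -> 0 < dg_form q (hform ipH iota) N a C D ->
    exists2 v, represents N t q v D & S v.
  move=> wC bD; have [v vD] := represented q tP D; exists v => //; split.
    exact: represents_Stau vD.
  apply: contrapT => v0; move: bD; rewrite -(repB _ _ _ _ wC vD).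
  rewrite (repB w v C 0 wC); first by rewrite (bil0r bbl) ltxx.
  move=> n nN s Js; rewrite /peval big1 => [|i _]; last by rewrite scaler0.
  apply: contrapT => vs; apply: v0; exists s; last exact/eqP.
  exact: (J_sub tP nN Js).
have le4 C := int_Y_le_norms q rho gl gp hp tau0 C.
have lower1 w : S w -> exists2 v, S v &
    infsup_const q alpha M K C0 <= B w v / (normX ipH iota N t w * normY iota N t v).
  move=> [wS w0]; have [C wC] := Stau_represents tP wS.
  have C_gt0 := iY0 w C wC w0; have [D [bD hD]] := primal C C_gt0.
  have [v vD Sv] := realize w C D wC bD; exists v => //.
  rewrite /B (repB w v C D wC vD) (nX w C wC) (nY v D vD).
  have [L _ /(_ D)[LD _]] := bnd C.
  apply: quotient_ge bD _ (sqrtr_ge0 _) hD LD.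
  by rewrite sqrtr_gt0 (lt_le_trans C_gt0)//; case: (le4 C).
have lower2 w : S w -> exists2 v, S v &
    adjoint_infsup_const q alpha M K C0 <= B w v / (tnormY iota N t w * tnormX ipH iota N t v).
  move=> [wS w0]; have [C wC] := Stau_represents tP wS.
  have C_gt0 := iY0 w C wC w0; have [D [bD hD]] := dual C C_gt0.
  have [v vD Sv] := realize w C D wC bD; exists v => //.
  rewrite /B (repB w v C D wC vD) (ntX v D vD) (ntY w C wC).
  have [L _ /(_ D)[_ LD]] := bnd C.
  apply: quotient_ge bD _ (sqrtr_ge0 _) hD LD.
  by rewrite sqrtr_gt0 (lt_le_trans C_gt0)//; case: (le4 C).
have h1 := inf_sup_ge S B _ _ _ lower1; have h2 := inf_sup_ge S B _ _ _ lower2.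
split=> // -[v0 v0N].
pose w0 : R -> V := fun=> v0.
have Sw : S w0.
  split; last by exists T => //=; rewrite in_itv/= T_gt0 lexx.
  move=> n nN; exists (fun i => if i == ord0 then v0 else 0) => s _.
  by rewrite big_ord_recl expr0 scale1r big1 ?addr0// => i _; rewrite scaler0.
have [C wC] := Stau_represents tP Sw.1; have C_gt0 := iY0 w0 C wC Sw.2.
have [L L0 LP] := bnd C.
split; rewrite fin_numElt; apply/andP; split.
- exact: lt_le_trans (ltNyr _) h1.
- apply: le_lt_trans (ltry (L / normX ipH iota N t w0)).
  apply: inf_sup_le Sw _ => v [vS _]; have [D vD] := Stau_represents tP vS.
  rewrite /B (repB _ _ _ _ wC vD) (nX _ _ wC) (nY _ _ vD).
  apply: quotient_le; rewrite ?sqrtr_ge0//; last by case: (LP D).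
  by rewrite sqrtr_gt0 (lt_le_trans C_gt0)//; case: (le4 C).
- exact: lt_le_trans (ltNyr _) h2.
- apply: le_lt_trans (ltry (L / tnormY iota N t w0)).
  apply: inf_sup_le Sw _ => v [vS _]; have [D vD] := Stau_represents tP vS.
  rewrite /B (repB _ _ _ _ wC vD) (ntX _ _ vD) (ntY _ _ wC).
  apply: quotient_le; rewrite ?sqrtr_ge0//; last by case: (LP D).
  by rewrite sqrtr_gt0 (lt_le_trans C_gt0)//; case: (le4 C).
Qed.
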